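(* Let $(a,b)\in S$ and $L=L_{a,b}$. Let $\bar p=(p_n)_{n\in\mathbb Z}$ be a bi-infinite sequence of symbols $+$ and $-$. Then $\bar p$ is essential $R$-admissible if and only if it is a sign-path in the folding tree of $L$.
   Context: Setting. $S$ is the set of $(a,b)\in\mathbb R^2$ with $b>0$, $a\sqrt2>b+2$, $b<\frac{a^2-1}{2a+1}$, $2a+b<4$. For $(a,b)\in S$, $L=L_{a,b}:\mathbb R^2\to\mathbb R^2$, $L(x,y)=(1+y-a|x|,\,bx)$, a homeomorphism. $X=(\frac1{1+a-b},\frac b{1+a-b})$ is a fixed point, hyperbolic (saddle). $R=\{T: L^{-n}(T)\to X \text{ as } n\to\infty\}$ is its unstable manifold; it is a broken line, the image of the real line under a continuous injective map, and is considered with the topology and arc length of the real line; $[A,B]\subset R$ denotes the arc of $R$ with endpoints $A,B$. $R^+$ is the half of $R$ starting at $X$ and going to the right; it first meets the horizontal axis at $Z=\bigl(\frac{2+a+\sqrt{a^2+4b}}{2(1+a-b)},0\bigr)$. $R^-$ is the other half. Order $R$ by $\triangleleft$ as the real line, with $R^-$ preceding $X$ and $R^+$ following $X$. Write $L^n(P)=(P^n_x,P^n_y)$. Basic points and arcs. $G\in R$ is a gluing point if $G_x=0$ and $G^{-k}_x\ne0$ for all integers $k\ge1$. Basic points are the points $L^j(G)$, $G$ gluing, $j\ge0$. They form a discrete set, numbered $\{E_i: i\in\mathbb Z\}$ with $E_0=L^{-1}(Z)$ and $E_i\triangleleft E_{i+1}$ for all $i$ (so $E_1=Z$). The arcs $[E_i,E_{i+1}]$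 are the basic arcs. Folding tree. It is the directed graph with vertex set $\mathbb Z$ (the vertex $i$ represents the basic arc $[E_i,E_{i+1}]$) with an arrow from $i$ to $j$ if and only if $L([E_i,E_{i+1}])\supset[E_j,E_{j+1}]$. The sign of the vertex $i$ is the sign ($+$ or $-$) of the $x$-coordinate on the interior of $[E_i,E_{i+1}]$ (it is constant and nonzero there). A sign-path is the bi-infinite sequence of signs of the vertices $(B_n)_{n\in\mathbb Z}$ of a bi-infinite path, i.e. one with an arrow from $B_n$ to $B_{n+1}$ for every $n\in\mathbb Z$. Essential itineraries. An itinerary of $P\in R$ is a sequence $\bar p=(p_n)_{n\in\mathbb Z}$ of symbols $+,-$ with $P^n_x\ge0$ whenever $p_n=+$ and $P^n_x\le0$ whenever $p_n=-$. If $P^n_x=0$ for some $n$, there is a smallest such $n$, call it $k$ (then $L^k(P)$ is a gluing point). If $l>k$ and $P^l_x=0$, then for all $Q\ne P$ close enough to $P$ in $R$ the numbers $Q^l_x$ are nonzero and have the same sign $s_l$. An itinerary $\bar p$ of $P$ is essential if $p_l=s_l$ for all such $l>k$ (no restriction on $p_k$). A sequence is essential $R$-admissible if it is an essential itinerary of some $P\in R$. *)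

(* Defs.v *)
(* Stdlib reals with Coquelicot. The unstable manifold R of the fixed point X is
   the set [unstable a b]; its line topology, its order and its arcs are read off
   a continuous injective parametrization [phi] by the real line. *)
From Stdlib Require Import Reals ZArith Lra.
From Coquelicot Require Import Coquelicot.
Open Scope R_scope.

Definition plane : Type := (R * R)%type.

Definition in_S (a b : R) : Prop :=
  0 < b /\ b + 2 < a * sqrt 2 /\ b < (a ^ 2 - 1) / (2 * a + 1) /\ 2 * a + b < 4.

Definition lozi (a b : R) (P : plane) : plane :=
  (1 + snd P - a * Rabs (fst P), b * fst P).

Definition lozi_inv (a b : R) (P : plane) : plane :=
  (snd P / b, fst P - 1 + a * Rabs (snd P / b)).

Lemma lozi_invK (a b : R) (P : plane) : b <> 0 -> lozi a b (lozi_inv a b P) = P.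
Proof.
intros hb; destruct P as [x y]; unfold lozi, lozi_inv; cbn [fst snd].
f_equal; [ring | field; exact hb].
Qed.

Lemma loziK (a b : R) (P : plane) : b <> 0 -> lozi_inv a b (lozi a b P) = P.
Proof.
intros hb; destruct P as [x y]; unfold lozi, lozi_inv; cbn [fst snd].
replace (b * x / b) with x by (field; exact hb).
f_equal; ring.
Qed.

Definition lozi_iter (a b : R) (n : Z) (P : plane) : plane :=
  match n with
  | Z0 => P
  | Zpos k => Nat.iter (Pos.to_nat k) (lozi a b) P
  | Zneg k => Nat.iter (Pos.to_nat k) (lozi_inv a b) P
  end.

Definition fixpt (a b : R) : plane := (1 / (1 + a - b), b / (1 + a - b)).

Definition unstable (a b : R) (T : plane) : Prop :=
  filterlim (fun n : nat => lozi_iter a b (- Z.of_nat n) T)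
    eventually (locally (fixpt a b)).

(* The last two fields fix the origin and the orientation, so that the images
   of [0, +oo) and (-oo, 0] are the half going to the right from the fixed
   point and the other half. *)
Record unstable_param (a b : R) (phi : R -> plane) : Prop := {
  param_continuous : forall t : R, continuous phi t;
  param_injective : forall s t : R, phi s = phi t -> s = t;
  param_range : forall T : plane, unstable a b T <-> exists t : R, phi t = T;
  param_origin : phi 0 = fixpt a b;
  param_right : exists e : R, 0 < e /\
    forall t : R, 0 < t < e -> fst (fixpt a b) < fst (phi t)
}.

Definition precedes (phi : R -> plane) (P Q : plane) : Prop :=
  exists s t : R, phi s = P /\ phi t = Q /\ s < t.

Definition arc (phi : R -> plane) (A B T : plane) : Prop :=
  exists r s t : R, phi r = A /\ phi s = T /\ phi t = B /\
    Rmin r t <= s <= Rmax r t.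

Definition arc_interior (phi : R -> plane) (A B T : plane) : Prop :=
  arc phi A B T /\ T <> A /\ T <> B.

Definition near_on (phi : R -> plane) (P : plane) (A : plane -> Prop) : Prop :=
  forall t : R, phi t = P -> locally t (fun s : R => phi s <> P -> A (phi s)).

Definition Zpoint (a b : R) : plane :=
  ((2 + a + sqrt (a ^ 2 + 4 * b)) / (2 * (1 + a - b)), 0).

Definition gluing (a b : R) (G : plane) : Prop :=
  unstable a b G /\ fst G = 0 /\
  forall k : Z, (1 <= k)%Z -> fst (lozi_iter a b (- k) G) <> 0.

Definition basic (a b : R) (P : plane) : Prop :=
  exists (G : plane) (j : nat),
    gluing a b G /\ P = lozi_iter a b (Z.of_nat j) G.

Record basic_numbering (a b : R) (phi : R -> plane) (E : Z -> plane) : Prop := {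
  numbering_basic : forall P : plane, basic a b P <-> exists i : Z, E i = P;
  numbering_zero : E 0%Z = lozi_iter a b (-1) (Zpoint a b);
  numbering_order : forall i : Z, precedes phi (E i) (E (i + 1)%Z)
}.

Definition tree_arrow (a b : R) (phi : R -> plane) (E : Z -> plane) (i j : Z) : Prop :=
  forall T : plane, arc phi (E j) (E (j + 1)%Z) T ->
    exists Q : plane, arc phi (E i) (E (i + 1)%Z) Q /\ lozi a b Q = T.

Inductive symbol : Set := Plus | Minus.

Definition weak_sign (s : symbol) (x : R) : Prop :=
  match s with Plus => 0 <= x | Minus => x <= 0 end.

Definition strict_sign (s : symbol) (x : R) : Prop :=
  match s with Plus => 0 < x | Minus => x < 0 end.

Definition vertex_sign (phi : R -> plane) (E : Z -> plane) (i : Z) (s : symbol) : Prop :=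
  forall T : plane, arc_interior phi (E i) (E (i + 1)%Z) T -> strict_sign s (fst T).

Definition sign_path (a b : R) (phi : R -> plane) (E : Z -> plane) (p : Z -> symbol) : Prop :=
  exists B : Z -> Z,
    (forall n : Z, tree_arrow a b phi E (B n) (B (n + 1)%Z)) /\
    (forall n : Z, vertex_sign phi E (B n) (p n)).

Definition itinerary (a b : R) (P : plane) (p : Z -> symbol) : Prop :=
  forall n : Z, weak_sign (p n) (fst (lozi_iter a b n P)).

Definition first_zero (a b : R) (P : plane) (k : Z) : Prop :=
  fst (lozi_iter a b k P) = 0 /\
  forall n : Z, (n < k)%Z -> fst (lozi_iter a b n P) <> 0.

(* [s] is the sign s_l: the common sign of Q^l_x for Q <> P close to P on R. *)
Definition side_sign (a b : R) (phi : R -> plane) (P : plane) (l : Z) (s : symbol) : Prop :=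
  near_on phi P (fun Q : plane => strict_sign s (fst (lozi_iter a b l Q))).

Definition essential_itinerary (a b : R) (phi : R -> plane) (P : plane)
    (p : Z -> symbol) : Prop :=
  itinerary a b P p /\
  forall k l : Z, first_zero a b P k -> (k < l)%Z ->
    fst (lozi_iter a b l P) = 0 -> side_sign a b phi P l (p l).

Definition essential_admissible (a b : R) (phi : R -> plane) (p : Z -> symbol) : Prop :=
  exists P : plane, unstable a b P /\ essential_itinerary a b phi P p.

(* Main.v *)
(* The map stretches the right-hand side eigenline of the fixed point X by the
   unstable eigenvalue lam < -1, so R has a natural parameter g : R -> plane with
   g (lam t) = L (g t).  Any other continuous injective parametrization phi of R
   is g o h for an increasing homeomorphism h: by Baire, h is bounded
   on a portion of the closed set C where it is locally unbounded, and it cannot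
   blow up at the end of a gap of C because g has no limit at either end.

   In the parameter of g the theorem is about the line, the map t |-> lam t, and
   the function x (t) = first coordinate of g t.  Zeros of x preceded by no other
   zero on their orbit are sign changes; all other zeros are local extrema, since
   folding at the vertical axis turns the curve back horizontally.  A path in the
   folding tree yields a point by intersecting nested intervals; conversely, the
   basic arcs containing the one-sided germs along the orbit of a point form a
   path, the side being chosen to match the free symbol at the first zero. *)
Require Import Defs.
From Stdlib Require Import Reals Ranalysis5 ZArith Lra Lia Classical ClassicalEpsilon.
From Coquelicot Require Import Coquelicot.
Open Scope R_scope.

(** * Lifting a parametrization through another one *)

(** The obstacle behind the lift is that [g] is not known to be a homeomorphism onto its image: the
    curve may come back close to itself, so nearby points of the plane may have distant parameters,
    and [h] is at first a mere function. On a bounded range of parameters compactness makes the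
    inverse of [g] continuous, so a discontinuity can only come from local unboundedness of [h].
    That [g] has no limit at its ends rests on [1 + b < a]: directions of slope at most [b] in
    modulus are mapped to such directions, without horizontal contraction, as long as the two points
    compared stay on one side of the vertical axis. The same inequality fixes the horizontal sense
    in which the curve leaves a fold. One side can serve at all times because only the first zero of
    an orbit tells the two sides apart: at a later zero both sides carry the same sign, and off the
    axis the sign is locally constant. *)

Definition dist1 (P Q : plane) : R := Rabs (fst P - fst Q) + Rabs (snd P - snd Q).

Lemma dist1_sym (P Q : plane) : dist1 P Q = dist1 Q P.
Proof. unfold dist1; rewrite (Rabs_minus_sym (fst P)), (Rabs_minus_sym (snd P)); reflexivity. Qed.

Lemma dist1_triangle (P Q T : plane) : dist1 P T <= dist1 P Q + dist1 Q T.
Proof.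
unfold dist1.
pose proof (Rabs_triang (fst P - fst Q) (fst Q - fst T)) as h1.
pose proof (Rabs_triang (snd P - snd Q) (snd Q - snd T)) as h2.
replace (fst P - fst Q + (fst Q - fst T)) with (fst P - fst T) in h1 by ring.
replace (snd P - snd Q + (snd Q - snd T)) with (snd P - snd T) in h2 by ring.
lra.
Qed.

Lemma dist1_pos (P Q : plane) : P <> Q -> 0 < dist1 P Q.
Proof.
intros hne; unfold dist1.
destruct (Req_dec (fst P) (fst Q)) as [e1|n1].
- destruct (Req_dec (snd P) (snd Q)) as [e2|n2].
  + exfalso; apply hne; destruct P, Q; cbn in *; congruence.
  + pose proof (Rabs_pos (fst P - fst Q)).
    pose proof (Rabs_pos_lt (snd P - snd Q)); lra.
- pose proof (Rabs_pos (snd P - snd Q)).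
  pose proof (Rabs_pos_lt (fst P - fst Q)); lra.
Qed.

Definition curve_cont (f : R -> plane) (t : R) : Prop :=
  forall eps, 0 < eps -> exists delta, 0 < delta /\
    forall s, Rabs (s - t) < delta -> dist1 (f s) (f t) < eps.

Definition limit_right (f : R -> plane) (q : plane) : Prop :=
  forall eps, 0 < eps -> exists M, forall s, M < s -> dist1 (f s) q < eps.

(** Reversal of the parameter reduces statements about the left end, or about lower bounds, to the
    right end and upper bounds. *)
Definition mirror (f : R -> plane) (t : R) : plane := f (- t).

Lemma mirror_cont (f : R -> plane) :
  (forall t, curve_cont f t) -> forall t, curve_cont (mirror f) t.
Proof.
intros hf t eps heps; destruct (hf (- t) eps heps) as [d [hd h]].
exists d; split; [exact hd|]; intros s hs; apply h.
replace (- s - - t) with (- (s - t)) by ring; rewrite Rabs_Ropp; exact hs.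
Qed.

Lemma eps_continuity_pt (f : R -> R) (t : R) :
  (forall eps, 0 < eps -> exists delta, 0 < delta /\
    forall s, Rabs (s - t) < delta -> Rabs (f s - f t) < eps) -> continuity_pt f t.
Proof.
intros h eps heps; destruct (h eps heps) as [d [hd h']].
exists d; split; [exact hd|]; intros s [_ hs]; apply h'; exact hs.
Qed.

Lemma continuity_pt_eps (f : R -> R) (t : R) : continuity_pt f t ->
  forall eps, 0 < eps -> exists delta, 0 < delta /\
    forall s, Rabs (s - t) < delta -> Rabs (f s - f t) < eps.
Proof.
intros h eps heps; destruct (h eps heps) as [d [hd h']].
exists d; split; [exact hd|]; intros s hs.
destruct (Req_dec s t) as [->|hne].
- rewrite Rminus_diag, Rabs_R0; exact heps.
- apply h'; split; [split; [exact I|congruence]|exact hs].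
Qed.

(** The distance to [P] attains a positive minimum on a compact interval. This is the form of
    compactness by which nearness in the plane controls the parameter. *)
Lemma curve_separation (f : R -> plane) (l r : R) (P : plane) :
  (forall t, curve_cont f t) -> (forall s, l <= s <= r -> f s <> P) ->
  exists eta, 0 < eta /\ forall s, l <= s <= r -> eta <= dist1 (f s) P.
Proof.
intros hf hP.
destruct (Rle_or_lt l r) as [hlr|hlr]; [|exists 1; split; [lra|intros; lra]].
assert (hc : forall c, l <= c <= r -> continuity_pt (fun s => dist1 (f s) P) c).
{ intros c _; apply eps_continuity_pt; intros eps heps.
  destruct (hf c eps heps) as [d [hd h]]; exists d; split; [exact hd|].
  intros s hs; specialize (h s hs).
  pose proof (dist1_triangle (f s) (f c) P) as h1.
  pose proof (dist1_triangle (f c) (f s) P) as h2.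
  rewrite (dist1_sym (f c) (f s)) in h2.
  apply Rabs_def1; lra. }
destruct (continuity_ab_min _ l r hlr hc) as [m [hm hml]].
exists (dist1 (f m) P); split; [apply dist1_pos, hP, hml|exact hm].
Qed.

Lemma IVT_range (f : R -> R) (u v y : R) : u <= v ->
  (forall t, u <= t <= v -> continuity_pt f t) ->
  (f u <= y <= f v \/ f v <= y <= f u) -> exists t, u <= t <= v /\ f t = y.
Proof.
assert (main : forall g : R -> R, u <= v ->
  (forall t, u <= t <= v -> continuity_pt g t) ->
  g u <= 0 <= g v -> exists t, u <= t <= v /\ g t = 0).
{ intros g huv hg [h1 h2].
  destruct (Req_dec (g u) 0) as [e|n]; [exists u; split; [lra|exact e]|].
  destruct (Req_dec (g v) 0) as [e|n']; [exists v; split; [lra|exact e]|].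
  destruct (Req_dec u v) as [e|n'']; [subst; lra|].
  destruct (IVT_interv g u v hg) as [z [hz e]]; [lra|lra|lra|].
  exists z; split; assumption. }
intros huv hf [hy|hy].
- destruct (main (fun t => f t - y) huv) as [t [ht e]]; [|lra|].
  + intros t ht; apply continuity_pt_minus; [apply hf, ht|].
    apply continuity_pt_const; intros ? ?; reflexivity.
  + exists t; split; [exact ht|lra].
- destruct (main (fun t => y - f t) huv) as [t [ht e]]; [|lra|].
  + intros t ht; apply continuity_pt_minus; [|apply hf, ht].
    apply continuity_pt_const; intros ? ?; reflexivity.
  + exists t; split; [exact ht|lra].
Qed.

(** If [f t] were outside the range spanned by the end values, one of these would be taken again on
    the other side of [t]. *)
Lemma IVT_injective_between (f : R -> R) (u v t : R) : u <= t <= v ->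
  (forall s, u <= s <= v -> continuity_pt f s) ->
  (forall r s, u <= r <= v -> u <= s <= v -> f r = f s -> r = s) ->
  f u <= f t <= f v \/ f v <= f t <= f u.
Proof.
intros ht hc hi.
destruct (Rle_or_lt (f u) (f t)) as [h1|h1], (Rle_or_lt (f t) (f v)) as [h2|h2];
  [lra| | |lra].
- destruct (Rle_or_lt (f u) (f v)) as [h3|h3].
  + destruct (IVT_range f u t (f v)) as [z [hz e]]; [lra|intros; apply hc; lra|lra|].
    assert (z = v) by (apply hi; lra); assert (t = v) by lra; subst t; lra.
  + destruct (IVT_range f t v (f u)) as [z [hz e]]; [lra|intros; apply hc; lra|lra|].
    assert (z = u) by (apply hi; lra); assert (t = u) by lra; subst t; lra.
- destruct (Rle_or_lt (f u) (f v)) as [h3|h3].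
  + destruct (IVT_range f t v (f u)) as [z [hz e]]; [lra|intros; apply hc; lra|lra|].
    assert (z = u) by (apply hi; lra); assert (t = u) by lra; subst t; lra.
  + destruct (IVT_range f u t (f v)) as [z [hz e]]; [lra|intros; apply hc; lra|lra|].
    assert (z = v) by (apply hi; lra); assert (t = v) by lra; subst t; lra.
Qed.

(** Here [h] is the inverse of [g] composed with [f]; its continuity is the goal. The last two
    fields replace properness of [g]: they prevent [h] from running off to infinity along an
    interval on which it is continuous. *)
Record curve_lift (f g : R -> plane) (h : R -> R) : Prop := {
  lift_eq : forall t, g (h t) = f t;
  lift_cont : forall t, curve_cont f t;
  lift_inj : forall s t, f s = f t -> s = t;
  base_cont : forall t, curve_cont g t;
  base_inj : forall s t, g s = g t -> s = t;
  base_right : forall q, ~ limit_right g q;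
  base_left : forall q, ~ limit_right (mirror g) q }.

Lemma lift_mirror (f g : R -> plane) (h : R -> R) :
  curve_lift f g h -> curve_lift (mirror f) g (fun t => h (- t)).
Proof.
intros H; destruct H as [h1 h2 h3 h4 h5 h6 h7]; split; try assumption.
- intros t; apply h1.
- apply mirror_cont, h2.
- intros s t e; apply h3 in e; lra.
Qed.

Lemma lift_opp (f g : R -> plane) (h : R -> R) :
  curve_lift f g h -> curve_lift f (mirror g) (fun t => - h t).
Proof.
intros H; destruct H as [h1 h2 h3 h4 h5 h6 h7]; split; try assumption.
- intros t; unfold mirror; rewrite Ropp_involutive; apply h1.
- apply mirror_cont, h4.
- intros s t e; apply h5 in e; lra.
- intros q hq; apply (h6 q); intros eps heps; destruct (hq eps heps) as [M hM].
  exists M; intros s hs; specialize (hM s hs); unfold mirror in hM.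
  rewrite Ropp_involutive in hM; exact hM.
Qed.

(** * Local boundedness of the lift *)

Definition bounded_between (h : R -> R) (u v : R) : Prop :=
  exists M, forall t, u <= t <= v -> Rabs (h t) <= M.

Definition unbounded_at (h : R -> R) (t : R) : Prop :=
  forall d, 0 < d -> ~ bounded_between h (t - d) (t + d).

(** On the two compact ranges from [- M] to [h t - eps] and from [h t + eps] to [M], the curve [g]
    keeps a positive distance from [f t]. Hence [f s] close to [f t] leaves only the window around
    [h t] for [h s]. *)
Lemma lift_continuity_within (f g : R -> plane) (h : R -> R) (u v t : R) :
  curve_lift f g h -> bounded_between h u v -> u <= t <= v ->
  forall eps, 0 < eps -> exists d, 0 < d /\
    forall s, u <= s <= v -> Rabs (s - t) < d -> Rabs (h s - h t) < eps.
Proof.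
intros H [M hM] ht eps heps.
destruct (curve_separation g (- M) (h t - eps) (f t)) as [e1 [he1 h1]].
{ apply (base_cont _ _ _ H). }
{ intros s hs e; rewrite <- (lift_eq _ _ _ H) in e; apply (base_inj _ _ _ H) in e; lra. }
destruct (curve_separation g (h t + eps) M (f t)) as [e2 [he2 h2]].
{ apply (base_cont _ _ _ H). }
{ intros s hs e; rewrite <- (lift_eq _ _ _ H) in e; apply (base_inj _ _ _ H) in e; lra. }
destruct (lift_cont _ _ _ H t (Rmin e1 e2)) as [d [hd h3]]; [apply Rmin_pos; lra|].
exists d; split; [exact hd|]; intros s hs hst.
specialize (h3 s hst); specialize (hM s hs).
apply Rabs_le_between in hM.
rewrite <- (lift_eq _ _ _ H s) in h3.
pose proof (Rmin_l e1 e2); pose proof (Rmin_r e1 e2).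
apply Rabs_def1.
- apply Rnot_le_lt; intros hn; specialize (h2 (h s)); lra.
- apply Rnot_le_lt; intros hn; specialize (h1 (h s)); lra.
Qed.

Lemma lift_continuity_pt (f g : R -> plane) (h : R -> R) (t : R) :
  curve_lift f g h -> ~ unbounded_at h t -> continuity_pt h t.
Proof.
intros H hu.
apply not_all_ex_not in hu; destruct hu as [d hu].
apply imply_to_and in hu; destruct hu as [hd hu]; apply NNPP in hu.
apply eps_continuity_pt; intros eps heps.
destruct (lift_continuity_within f g h _ _ t H hu) with (eps := eps) as [d' [hd' h']];
  [lra|exact heps|].
exists (Rmin d d'); split; [apply Rmin_pos; lra|].
intros s hs; pose proof (Rmin_l d d'); pose proof (Rmin_r d d').
apply h'; [apply Rabs_def2 in hs; lra|lra].
Qed.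

(** Composition with this retraction onto [u, v] turns continuity relative to the interval into the
    two-sided continuity that [continuity_pt] demands at its end points. *)
Definition clamp (u v t : R) : R := Rmax u (Rmin v t).

Lemma clamp_range (u v t : R) : u <= v -> u <= clamp u v t <= v.
Proof.
intros huv; unfold clamp; split; [apply Rmax_l|].
apply Rmax_lub; [exact huv|apply Rmin_l].
Qed.

Lemma clamp_id (u v t : R) : u <= t <= v -> clamp u v t = t.
Proof. intros ht; unfold clamp; rewrite Rmin_right, Rmax_right; lra. Qed.

Lemma clamp_lipschitz (u v s t : R) : Rabs (clamp u v s - clamp u v t) <= Rabs (s - t).
Proof.
unfold clamp, Rmax, Rmin.
destruct (Rle_dec v s), (Rle_dec v t); repeat destruct Rle_dec; split_Rabs; lra.
Qed.

Lemma lift_between (f g : R -> plane) (h : R -> R) (u v t : R) :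
  curve_lift f g h -> bounded_between h u v -> u <= t <= v ->
  h u <= h t <= h v \/ h v <= h t <= h u.
Proof.
intros H hb ht.
pose (k := fun s => h (clamp u v s)).
assert (ek : forall s, u <= s <= v -> k s = h s).
{ intros s hs; unfold k; rewrite clamp_id by exact hs; reflexivity. }
rewrite <- (ek u), <- (ek v), <- (ek t) by lra.
apply IVT_injective_between; [exact ht| |].
- intros s hs; apply eps_continuity_pt; intros eps heps.
  destruct (lift_continuity_within f g h u v (clamp u v s) H hb) with (eps := eps)
    as [d [hd h']]; [apply clamp_range; lra|exact heps|].
  exists d; split; [exact hd|]; intros r hr; apply h'; [apply clamp_range; lra|].
  eapply Rle_lt_trans; [apply clamp_lipschitz|exact hr].
- intros r s hr hs; rewrite !ek by assumption; intros e.
  apply (lift_inj _ _ _ H); rewrite <- !(lift_eq _ _ _ H), e; reflexivity.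
Qed.

(** Otherwise, by intermediate values, every large [s] is [h z] with [z] as close to [u] as desired,
    so that [g s = f z] tends to [f u]: a forbidden limit of [g] at its right end. *)
Lemma lift_bounded_above (f g : R -> plane) (h : R -> R) (u w : R) :
  curve_lift f g h -> u < w -> (forall t, u < t <= w -> continuity_pt h t) ->
  exists K v, u < v <= w /\ forall t, u < t < v -> h t <= K.
Proof.
intros H huw hc; apply NNPP; intros hn.
apply (base_right _ _ _ H (f u)); intros eps heps.
destruct (lift_cont _ _ _ H u eps heps) as [d [hd hf]].
pose (v := Rmin w (u + d / 2)).
assert (hv : u < v <= w /\ v < u + d).
{ unfold v; pose proof (Rmin_l w (u + d / 2)); pose proof (Rmin_r w (u + d / 2)).
  split; [split; [apply Rmin_glb_lt; lra|lra]|lra]. }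
exists (h v); intros s hs.
assert (ht : exists t, u < t < v /\ s < h t).
{ apply NNPP; intros hn'; apply hn; exists s, v; split; [lra|].
  intros t ht; apply Rnot_lt_le; intros hlt; apply hn'; exists t; split; assumption. }
destruct ht as [t [ht hst]].
destruct (IVT_range h t v s) as [z [hz e]]; [lra|intros; apply hc; lra|lra|].
rewrite <- e, (lift_eq _ _ _ H); apply hf; apply Rabs_def1; lra.
Qed.

Lemma lift_bounded_right (f g : R -> plane) (h : R -> R) (u w : R) :
  curve_lift f g h -> u < w -> (forall t, u < t <= w -> ~ unbounded_at h t) ->
  bounded_between h u w.
Proof.
intros H huw hu.
assert (hc : forall t, u < t <= w -> continuity_pt h t).
{ intros t ht; apply (lift_continuity_pt f g h t H (hu t ht)). }
destruct (lift_bounded_above f g h u w H huw hc) as [K1 [v1 [hv1 h1]]].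
(* A lower bound for [h] is an upper bound for [- h], which lifts [f] through the reversed base
   curve. *)
destruct (lift_bounded_above f (mirror g) (fun t => - h t) u w (lift_opp _ _ _ H) huw)
  as [K2 [v2 [hv2 h2]]].
{ intros t ht; apply (continuity_pt_opp h), hc, ht. }
pose (m := (u + Rmin v1 v2) / 2).
assert (hm : u < m < Rmin v1 v2).
{ assert (u < Rmin v1 v2) by (apply Rmin_glb_lt; lra); unfold m; lra. }
pose proof (Rmin_l v1 v2); pose proof (Rmin_r v1 v2).
destruct (continuity_ab_maj h m w) as [xM [hM _]]; [lra|intros; apply hc; lra|].
destruct (continuity_ab_min h m w) as [xm [hmin _]]; [lra|intros; apply hc; lra|].
(* The value at [u] enters separately, since [h] may be discontinuous there. *)
exists (Rabs (h u) + Rabs K1 + Rabs K2 + Rabs (h xM) + Rabs (h xm)).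
intros t ht.
destruct (Req_dec t u) as [->|hne].
{ pose proof (Rabs_pos K1); pose proof (Rabs_pos K2).
  pose proof (Rabs_pos (h xM)); pose proof (Rabs_pos (h xm)); lra. }
destruct (Rle_or_lt m t) as [hmt|hmt].
- specialize (hM t); specialize (hmin t).
  assert (h xm <= h t <= h xM) by (split; [apply hmin|apply hM]; lra).
  split_Rabs; lra.
- specialize (h1 t); specialize (h2 t).
  assert (- K2 <= h t <= K1) by (split; [apply Ropp_le_cancel; rewrite Ropp_involutive;
    apply h2|apply h1]; lra).
  split_Rabs; lra.
Qed.

Lemma unbounded_at_mirror (h : R -> R) (t : R) :
  unbounded_at (fun s => h (- s)) t -> unbounded_at h (- t).
Proof.
intros hu d hd [M hM]; apply (hu d hd); exists M; intros s hs; apply hM; lra.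
Qed.

Lemma lift_bounded_left (f g : R -> plane) (h : R -> R) (u w : R) :
  curve_lift f g h -> u < w -> (forall t, u <= t < w -> ~ unbounded_at h t) ->
  bounded_between h u w.
Proof.
intros H huw hu.
destruct (lift_bounded_right (mirror f) g (fun t => h (- t)) (- w) (- u)) as [M hM].
- apply lift_mirror, H.
- lra.
- intros t ht hn; apply unbounded_at_mirror in hn; apply (hu (- t)); [lra|exact hn].
- exists M; intros t ht; specialize (hM (- t)); rewrite Ropp_involutive in hM.
  apply hM; lra.
Qed.

Lemma unbounded_at_closed (h : R -> R) (t : R) : ~ unbounded_at h t ->
  exists d, 0 < d /\ forall s, Rabs (s - t) < d -> ~ unbounded_at h s.
Proof.
intros hu.
apply not_all_ex_not in hu; destruct hu as [d hu].
apply imply_to_and in hu; destruct hu as [hd hu]; apply NNPP in hu.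
destruct hu as [M hM].
exists (d / 2); split; [lra|]; intros s hs hn; apply (hn (d / 2)); [lra|].
exists M; intros r hr; apply hM; apply Rabs_def2 in hs; lra.
Qed.

Lemma closed_last (C : R -> Prop) (c t : R) : C c -> c <= t ->
  (forall r, ~ C r -> exists d, 0 < d /\ forall s, Rabs (s - r) < d -> ~ C s) ->
  exists u, c <= u <= t /\ C u /\ forall s, u < s <= t -> ~ C s.
Proof.
intros hc hct hcl.
destruct (completeness (fun s => C s /\ s <= t)) as [u [hu1 hu2]].
{ exists t; intros s [_ hs]; exact hs. }
{ exists c; split; assumption. }
assert (h1 : c <= u) by (apply hu1; split; assumption).
assert (h2 : u <= t) by (apply hu2; intros s [_ hs]; exact hs).
exists u; split; [lra|split].
- apply NNPP; intros hn; destruct (hcl u hn) as [d [hd hd']].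
  assert (u <= u - d / 2); [|lra].
  apply hu2; intros s [hs1 hs2]; apply Rnot_lt_le; intros hlt.
  assert (s <= u) by (apply hu1; split; assumption).
  apply (hd' s); [apply Rabs_def1; lra|exact hs1].
- intros s hs hCs; assert (s <= u) by (apply hu1; split; [exact hCs|lra]); lra.
Qed.

Lemma closed_first (C : R -> Prop) (t c : R) : C c -> t <= c ->
  (forall r, ~ C r -> exists d, 0 < d /\ forall s, Rabs (s - r) < d -> ~ C s) ->
  exists v, t <= v <= c /\ C v /\ forall s, t <= s < v -> ~ C s.
Proof.
intros hc hct hcl.
destruct (closed_last (fun s => C (- s)) (- c) (- t)) as [u [hu1 [hu2 hu3]]].
- rewrite Ropp_involutive; exact hc.
- lra.
- intros r hr; destruct (hcl _ hr) as [d [hd h]]; exists d; split; [exact hd|].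
  intros s hs; apply h; replace (- s - - r) with (- (s - r)) by ring.
  rewrite Rabs_Ropp; exact hs.
- exists (- u); split; [lra|split; [exact hu2|]].
  intros s hs; specialize (hu3 (- s)); rewrite Ropp_involutive in hu3; apply hu3; lra.
Qed.

Lemma bounded_between_join (h : R -> R) (u v w : R) :
  bounded_between h u v -> bounded_between h v w -> bounded_between h u w.
Proof.
intros [M1 h1] [M2 h2]; exists (Rmax M1 M2); intros t ht.
destruct (Rle_or_lt t v).
- eapply Rle_trans; [apply h1; lra|apply Rmax_l].
- eapply Rle_trans; [apply h2; lra|apply Rmax_r].
Qed.

Lemma bounded_between_sub (h : R -> R) (u v u' v' : R) :
  u <= u' -> v' <= v -> bounded_between h u v -> bounded_between h u' v'.
Proof. intros h1 h2 [M hM]; exists M; intros t ht; apply hM; lra. Qed.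

(* On each gap of the set where h is locally unbounded, h lies between its values
   at the two ends of the gap. *)
Lemma lift_bounded_after (f g : R -> plane) (h : R -> R) (c r M : R) :
  curve_lift f g h -> 0 < r -> unbounded_at h c ->
  (forall t, Rabs (t - c) < r -> unbounded_at h t -> Rabs (h t) <= M) ->
  exists w, c < w /\ bounded_between h c w.
Proof.
intros H hr hc hM.
(* Either [c] is the left end of a gap, or locally unbounded points accumulate at [c] from the
   right; in the second case a point [c1] of that set closes off the interval, and every [t] before
   it lies in the set or in a gap. *)
destruct (classic (exists w, c < w /\ forall t, c < t <= w -> ~ unbounded_at h t))
  as [[w [hw hu]]|hn].
{ exists w; split; [exact hw|]; apply (lift_bounded_right f g h c w H hw hu). }
assert (hc1 : exists c1, c < c1 < c + r /\ unbounded_at h c1).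
{ apply NNPP; intros hn'; apply hn; exists (c + r / 2); split; [lra|].
  intros t ht htu; apply hn'; exists t; split; [lra|exact htu]. }
destruct hc1 as [c1 [hc1 hu1]].
exists c1; split; [lra|]; exists M; intros t ht.
destruct (classic (unbounded_at h t)) as [htu|htu].
{ apply hM; [apply Rabs_def1; lra|exact htu]. }
destruct (closed_last (unbounded_at h) c t hc) as [u [hu [huu hul]]];
  [lra|apply unbounded_at_closed|].
destruct (closed_first (unbounded_at h) t c1 hu1) as [v [hv [hvu hvf]]];
  [lra|apply unbounded_at_closed|].
assert (hut : u <> t) by (intros ->; contradiction).
assert (hvt : v <> t) by (intros ->; contradiction).
assert (hb : bounded_between h u v).
{ apply bounded_between_join with t.
  - apply (lift_bounded_right f g); [exact H|lra|exact hul].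
  - apply (lift_bounded_left f g); [exact H|lra|exact hvf]. }
assert (h1 : Rabs (h u) <= M) by (apply hM; [apply Rabs_def1; lra|exact huu]).
assert (h2 : Rabs (h v) <= M) by (apply hM; [apply Rabs_def1; lra|exact hvu]).
pose proof (lift_between f g h u v t H hb ltac:(lra)) as h3.
apply Rabs_le_between in h1, h2; apply Rcomplements.Rabs_le_between; lra.
Qed.

(** * The category argument *)

(** The Baire property of a closed set, for open sets dense relative to it: closed intervals centred
    at points of [C] are nested with radii at least halved, and the common point belongs to [C] as
    the limit of the centres. *)
Lemma baire_closed (C : R -> Prop) (U : nat -> R -> Prop) (c0 : R) : C c0 ->
  (forall r, ~ C r -> exists d, 0 < d /\ forall s, Rabs (s - r) < d -> ~ C s) ->
  (forall n t, U n t -> exists d, 0 < d /\ forall s, Rabs (s - t) < d -> U n s) ->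
  (forall n c r, C c -> 0 < r -> exists t, Rabs (t - c) < r /\ C t /\ U n t) ->
  exists c, C c /\ forall n, U n c.
Proof.
intros hc0 hcl ho hd.
(* The pair (centre, radius) carries its invariant in its type, so that the choice of the next
   interval can be iterated. *)
assert (step : forall (n : nat) (z : {z : R * R | C (fst z) /\ 0 < snd z}),
  {z' : {z : R * R | C (fst z) /\ 0 < snd z} |
    snd (proj1_sig z') <= snd (proj1_sig z) / 2 /\
    (forall s, Rabs (s - fst (proj1_sig z')) <= snd (proj1_sig z') ->
      Rabs (s - fst (proj1_sig z)) <= snd (proj1_sig z) /\ U n s)}).
{ intros n [[c r] [hc hr]]; cbn [fst snd proj1_sig] in *.
  apply constructive_indefinite_description.
  destruct (hd n c r hc hr) as [t [ht [hCt hUt]]].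
  destruct (ho n t hUt) as [d [hd1 hd2]].
  (* The three bounds serve convergence, inclusion of the closed interval in [U n], and inclusion in
     the previous interval. *)
  assert (hr' : 0 < Rmin (r / 2) (Rmin (d / 2) (r - Rabs (t - c)))).
  { apply Rmin_pos; [lra|apply Rmin_pos; lra]. }
  exists (exist _ (t, _) (conj hCt hr')); cbn [fst snd proj1_sig].
  pose proof (Rmin_l (r / 2) (Rmin (d / 2) (r - Rabs (t - c)))) as e1.
  pose proof (Rmin_r (r / 2) (Rmin (d / 2) (r - Rabs (t - c)))) as e2.
  pose proof (Rmin_l (d / 2) (r - Rabs (t - c))) as e3.
  pose proof (Rmin_r (d / 2) (r - Rabs (t - c))) as e4.
  split; [exact e1|]; intros s hs; split.
  - replace (s - c) with ((s - t) + (t - c)) by ring.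
    eapply Rle_trans; [apply Rabs_triang|lra].
  - apply hd2; lra. }
pose (z0 := exist (fun z : R * R => C (fst z) /\ 0 < snd z) (c0, 1) (conj hc0 Rlt_0_1)).
pose (z := fix z n := match n with O => z0 | S m => proj1_sig (step m (z m)) end).
pose (c := fun n => fst (proj1_sig (z n))); pose (r := fun n => snd (proj1_sig (z n))).
assert (hC : forall n, C (c n) /\ 0 < r n) by (intros n; exact (proj2_sig (z n))).
assert (hr : forall n, r (S n) <= r n / 2).
{ intros n; exact (proj1 (proj2_sig (step n (z n)))). }
assert (hin : forall n s, Rabs (s - c (S n)) <= r (S n) -> Rabs (s - c n) <= r n /\ U n s).
{ intros n; exact (proj2 (proj2_sig (step n (z n)))). }
assert (hnest : forall m n s, Rabs (s - c (n + m)%nat) <= r (n + m)%nat -> Rabs (s - c n) <= r n).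
{ induction m as [|m IH]; intros n s hs.
  - rewrite Nat.add_0_r in hs; exact hs.
  - apply IH; apply hin; rewrite Nat.add_succ_r in hs; exact hs. }
assert (hle : forall n m, c n - r n <= c m + r m).
{ intros n m.
  destruct (Nat.le_ge_cases n m) as [hnm|hnm].
  - assert (h1 : Rabs (c m - c n) <= r n).
    { apply (hnest (m - n)%nat); replace (n + (m - n))%nat with m by lia.
      rewrite Rminus_diag, Rabs_R0; apply Rlt_le, hC. }
    apply Rabs_le_between in h1; pose proof (proj2 (hC m)); lra.
  - assert (h1 : Rabs (c n - c m) <= r m).
    { apply (hnest (n - m)%nat); replace (m + (n - m))%nat with n by lia.
      rewrite Rminus_diag, Rabs_R0; apply Rlt_le, hC. }
    apply Rabs_le_between in h1; pose proof (proj2 (hC n)); lra. }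
destruct (completeness (fun y => exists n, y = c n - r n)) as [l [hl1 hl2]].
{ exists (c O + r O); intros y [n ->]; apply hle. }
{ exists (c O - r O), O; reflexivity. }
assert (hl : forall n, Rabs (l - c n) <= r n).
{ intros n; apply Rabs_le_between.
  assert (c n - r n <= l) by (apply hl1; exists n; reflexivity).
  assert (l <= c n + r n) by (apply hl2; intros y [m ->]; apply hle).
  lra. }
exists l; split.
- apply NNPP; intros hn; destruct (hcl l hn) as [d [hd1 hd2]].
  assert (hpow : forall n, r n <= (/ 2) ^ n).
  { induction n as [|n IH]; [apply Rle_refl|].
    specialize (hr n); cbn [pow]; lra. }
  destruct (pow_lt_1_zero (/ 2) ltac:(rewrite Rabs_pos_eq; lra) d hd1) as [N hN].
  specialize (hN N (le_n N)); rewrite Rabs_pos_eq in hN by (apply pow_le; lra).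
  apply (hd2 (c N)); [|apply hC].
  rewrite Rabs_minus_sym; specialize (hl N); specialize (hpow N); lra.
- intros n; apply (hin n l), hl.
Qed.

(** If the locally unbounded set is nonempty, the sets where [|h|] exceeds [n] are open, and dense
    relative to it: a portion of it on which [h] is bounded would make [h] bounded near one of its
    own points. A point common to all of them would have an infinite [h]. *)
Lemma lift_continuous (f g : R -> plane) (h : R -> R) :
  curve_lift f g h -> forall t, continuity_pt h t.
Proof.
intros H t; apply (lift_continuity_pt f g h t H); intros ht.
destruct (baire_closed (unbounded_at h) (fun n s => INR n < Rabs (h s)) t ht) as [c [_ hc]].
- apply unbounded_at_closed.
- intros n s hs.
  (* Openness: [f s] is off the compact piece of [g] over [-n, n], hence so are the nearby points of
     [f]. *)
  destruct (curve_separation g (- INR n) (INR n) (f s)) as [e [he hsep]].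
  { apply (base_cont _ _ _ H). }
  { intros r hr e; rewrite <- (lift_eq _ _ _ H) in e; apply (base_inj _ _ _ H) in e; subst r.
    apply Rabs_le_between in hr; lra. }
  destruct (lift_cont _ _ _ H s e he) as [d [hd hf]].
  exists d; split; [exact hd|]; intros r hr; apply Rnot_le_lt; intros hn.
  apply Rabs_le_between in hn; specialize (hsep _ hn); specialize (hf r hr).
  rewrite (lift_eq _ _ _ H) in hsep; lra.
- intros n c r hc hr; apply NNPP; intros hn.
  assert (hb : forall s, Rabs (s - c) < r -> unbounded_at h s -> Rabs (h s) <= INR n).
  { intros s hs hu; apply Rnot_lt_le; intros hlt; apply hn; exists s; auto. }
  destruct (lift_bounded_after f g h c r (INR n) H hr hc hb) as [w [hw hbw]].
  destruct (lift_bounded_after (mirror f) g (fun s => h (- s)) (- c) r (INR n))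
    as [w' [hw' hbw']].
  + apply lift_mirror, H.
  + exact hr.
  + intros d hd [M hM]; apply (hc d hd); exists M; intros s hs; specialize (hM (- s)).
    rewrite Ropp_involutive in hM; apply hM; lra.
  + intros s hs hu; apply hb; [|apply unbounded_at_mirror, hu].
    replace (- s - c) with (- (s - - c)) by ring; rewrite Rabs_Ropp; exact hs.
  + assert (hbl : bounded_between h (- w') c).
    { destruct hbw' as [M hM]; exists M; intros s hs; specialize (hM (- s)).
      rewrite Ropp_involutive in hM; apply hM; lra. }
    pose proof (bounded_between_join h _ _ _ hbl hbw) as hb2.
    apply (hc (Rmin (w - c) (c + w'))); [apply Rmin_pos; lra|].
    pose proof (Rmin_l (w - c) (c + w')); pose proof (Rmin_r (w - c) (c + w')).
    apply bounded_between_sub with (- w') w; [lra|lra|exact hb2].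
- destruct (INR_unbounded (Rabs (h c))) as [N hN]; specialize (hc N); lra.
Qed.

(** All of [s], [t], 0 and [d] are placed between [u] and [v]; betweenness of the images then
    carries the orientation of the pair 0, [d] over to [s], [t]. *)
Lemma continuous_injective_increasing (h : R -> R) (d : R) :
  (forall t, continuity_pt h t) -> (forall s t, h s = h t -> s = t) ->
  0 < d -> h 0 < h d -> forall s t, s < t -> h s < h t.
Proof.
intros hc hi hd h0d s t hst.
pose (u := Rmin s 0); pose (v := Rmax t d).
assert (hu : u <= s /\ u <= 0) by (split; [apply Rmin_l|apply Rmin_r]).
assert (hv : t <= v /\ d <= v) by (split; [apply Rmax_l|apply Rmax_r]).
assert (between : forall x y z, x <= y <= z ->
  h x <= h y <= h z \/ h z <= h y <= h x).
{ intros x y z hxyz; apply IVT_injective_between; auto. }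
assert (hne : forall x y, x < y -> h x <> h y) by (intros x y hxy e; apply hi in e; lra).
pose proof (between u 0 v ltac:(lra)).
pose proof (between u d v ltac:(lra)).
pose proof (between 0 d v ltac:(lra)).
pose proof (between u s v ltac:(lra)).
pose proof (between u t v ltac:(lra)).
pose proof (between u s t ltac:(lra)).
pose proof (between s t v ltac:(lra)).
pose proof (hne 0 d hd); pose proof (hne s t hst); pose proof (hne u v ltac:(lra)).
lra.
Qed.

(** * Folding on the line *)

Definition symbol_sign (s : symbol) : R := match s with Plus => 1 | Minus => -1 end.

Lemma weak_signE (s : symbol) (x : R) : weak_sign s x <-> 0 <= symbol_sign s * x.
Proof. destruct s; cbn; lra. Qed.

Lemma strict_signE (s : symbol) (x : R) : strict_sign s x <-> 0 < symbol_sign s * x.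
Proof. destruct s; cbn; lra. Qed.

Lemma symbol_sign_agree (s : symbol) (c x y : R) :
  0 < symbol_sign s * x -> 0 < c * x -> 0 < c * y -> 0 < symbol_sign s * y.
Proof. destruct s; cbn; nra. Qed.

(** The interface between the plane and the combinatorics; [t / lam ^ j] is the parameter of the
    j-th preimage. The number [c] matters through its sign only: the sense in which [x] crosses zero
    in [fold_cross], the common sign on both sides in [fold_turn]. *)
Record folded (lam : R) (x : R -> R) : Prop := {
  fold_lam : lam < -1;
  fold_cont : forall t, continuity_pt x t;
  fold_pos : exists r, 0 < r /\ forall t, Rabs t < r -> 0 < x t;
  fold_cross : forall t, x t = 0 -> (forall j, (1 <= j)%nat -> x (t / lam ^ j) <> 0) ->
    exists c d, 0 < d /\ forall s, 0 < Rabs (s - t) < d -> 0 < c * ((s - t) * x s);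
  fold_turn : forall t j, x t = 0 -> (1 <= j)%nat -> x (t / lam ^ j) = 0 ->
    exists c d, 0 < d /\ forall s, 0 < Rabs (s - t) < d -> 0 < c * x s }.

Record marks (lam : R) (x : R -> R) (e : Z -> R) : Prop := {
  marks_lt : forall i, e i < e (i + 1)%Z;
  marks_range : forall t, (exists i, e i = t) <-> exists j : nat, x (t / lam ^ j) = 0 }.

(** An arrow is written through the inverse map: division by [lam] sends the target interval into
    the source interval. In this form the conditions at successive times are nested. *)
Definition line_path (lam : R) (x : R -> R) (e : Z -> R) (p : Z -> symbol) : Prop :=
  exists B : Z -> Z,
    (forall n s, e (B (n + 1)%Z) <= s <= e (B (n + 1) + 1)%Z ->
      e (B n) <= s / lam <= e (B n + 1)%Z) /\
    (forall n s, e (B n) < s < e (B n + 1)%Z -> strict_sign (p n) (x s)).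

Definition line_essential (lam : R) (x : R -> R) (p : Z -> symbol) : Prop :=
  exists t, (forall n, weak_sign (p n) (x (powerRZ lam n * t))) /\
    forall k l, x (powerRZ lam k * t) = 0 ->
      (forall n, (n < k)%Z -> x (powerRZ lam n * t) <> 0) -> (k < l)%Z ->
      x (powerRZ lam l * t) = 0 ->
      exists d, 0 < d /\ forall s, 0 < Rabs (s - t) < d ->
        strict_sign (p l) (x (powerRZ lam l * s)).

Lemma continuity_pt_pos (f : R -> R) (t c : R) : continuity_pt f t -> 0 < c * f t ->
  exists d, 0 < d /\ forall s, Rabs (s - t) < d -> 0 < c * f s.
Proof.
intros hf hc.
assert (hg : continuity_pt (fun s => c * f s) t) by (apply (continuity_pt_scal f), hf).
destruct (continuity_pt_eps _ _ hg _ hc) as [d [hd h]].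
exists d; split; [exact hd|]; intros s hs; specialize (h s hs).
apply Rabs_def2 in h; lra.
Qed.

(** * Order and discreteness of the marks *)

Lemma marks_mono (e : Z -> R) : (forall i, e i < e (i + 1)%Z) ->
  forall i j, (i < j)%Z -> e i < e j.
Proof.
intros he i j hij.
assert (h : forall n : nat, e i < e (i + Z.of_nat (S n))%Z).
{ induction n as [|n IH]; [apply he|].
  eapply Rlt_trans; [exact IH|].
  replace (i + Z.of_nat (S (S n)))%Z with (i + Z.of_nat (S n) + 1)%Z by lia; apply he. }
specialize (h (Z.to_nat (j - i - 1))).
replace (i + Z.of_nat (S (Z.to_nat (j - i - 1))))%Z with j in h by lia; exact h.
Qed.

Lemma marks_mono_le (e : Z -> R) : (forall i, e i < e (i + 1)%Z) ->
  forall i j, (i <= j)%Z -> e i <= e j.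
Proof.
intros he i j hij; destruct (Z.eq_dec i j) as [->|hne]; [apply Rle_refl|].
apply Rlt_le, marks_mono; [exact he|lia].
Qed.

Lemma folded_pow_neq (lam : R) (x : R -> R) (n : nat) : folded lam x -> lam ^ n <> 0.
Proof. intros H; apply pow_nonzero; pose proof (fold_lam _ _ H); lra. Qed.

Lemma folded_powerRZ_neq (lam : R) (x : R -> R) (n : Z) : folded lam x -> powerRZ lam n <> 0.
Proof. intros H; apply powerRZ_NOR; pose proof (fold_lam _ _ H); lra. Qed.

Lemma powerRZ_succ (lam : R) (n : Z) : lam <> 0 -> powerRZ lam (n + 1) = lam * powerRZ lam n.
Proof. intros h; rewrite powerRZ_add by exact h; rewrite powerRZ_1; ring. Qed.

Lemma powerRZ_sub_nat (lam : R) (n : Z) (j : nat) (t : R) : lam <> 0 ->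
  powerRZ lam n * t / lam ^ j = powerRZ lam (n - Z.of_nat j) * t.
Proof.
intros h; unfold Z.sub; rewrite powerRZ_add by exact h.
rewrite powerRZ_neg', <- pow_powerRZ; field.
apply pow_nonzero, h.
Qed.

Lemma div_pow_small (lam r K : R) : lam < -1 -> 0 < r ->
  exists N : nat, forall n s, (N <= n)%nat -> Rabs s <= K -> Rabs (s / lam ^ n) < r.
Proof.
intros hl hr.
destruct (Pow_x_infinity (- lam) ltac:(rewrite Rabs_pos_eq; lra) (Rabs K / r + 1))
  as [N hN].
exists N; intros n s hn hs; specialize (hN n hn).
rewrite <- RPow_abs, Rabs_Ropp, RPow_abs in hN.
assert (hp : 0 < Rabs (lam ^ n)) by (apply Rabs_pos_lt, pow_nonzero; lra).
unfold Rdiv; rewrite Rabs_mult, Rabs_inv.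
apply Rmult_lt_reg_r with (Rabs (lam ^ n)); [exact hp|].
rewrite Rmult_assoc, Rinv_l, Rmult_1_r by lra.
assert (Rabs K < r * Rabs (lam ^ n)).
{ apply Rmult_lt_reg_r with (/ r); [apply Rinv_0_lt_compat, hr|].
  replace (r * Rabs (lam ^ n) * / r) with (Rabs (lam ^ n)) by (field; lra).
  unfold Rdiv in hN; lra. }
pose proof (Rle_abs K); lra.
Qed.

Lemma folded_zero_isolated (lam : R) (x : R -> R) (t : R) : folded lam x ->
  exists d, 0 < d /\ forall s, 0 < Rabs (s - t) < d -> x s <> 0.
Proof.
intros H; destruct (Req_dec (x t) 0) as [e|n].
- destruct (classic (exists j, (1 <= j)%nat /\ x (t / lam ^ j) = 0)) as [[j [hj ej]]|hn].
  + destruct (fold_turn _ _ H t j e hj ej) as [c [d [hd h]]].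
    exists d; split; [exact hd|]; intros s hs e0; specialize (h s hs); rewrite e0 in h; lra.
  + destruct (fold_cross _ _ H t e) as [c [d [hd h]]].
    { intros j hj ej; apply hn; exists j; auto. }
    exists d; split; [exact hd|]; intros s hs e0; specialize (h s hs); rewrite e0 in h; lra.
- destruct (continuity_pt_pos x t (x t) (fold_cont _ _ H t)) as [d [hd h]]; [nra|].
  exists d; split; [exact hd|]; intros s hs e0; specialize (h s (proj2 hs)).
  rewrite e0 in h; lra.
Qed.

(** Near [t], all preimages from some [N] on fall into the neighbourhood of 0 where [x] is positive.
    So only finitely many [j] can produce marks, and each contributes isolated zeros. *)
Lemma marks_isolated (lam : R) (x : R -> R) (e : Z -> R) (t : R) :
  folded lam x -> marks lam x e ->
  exists d, 0 < d /\ forall s, 0 < Rabs (s - t) < d -> forall i, e i <> s.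
Proof.
intros H M.
destruct (fold_pos _ _ H) as [r [hr hpos]].
destruct (div_pow_small lam r (Rabs t + 1) (fold_lam _ _ H) hr) as [N hN].
assert (hd : forall m : nat, exists d, 0 < d /\ forall s, 0 < Rabs (s - t) < d ->
  forall j, (j < m)%nat -> x (s / lam ^ j) <> 0).
{ induction m as [|m [d [hd IH]]]; [exists 1; split; [lra|intros; lia]|].
  destruct (folded_zero_isolated lam x (t / lam ^ m) H) as [d' [hd' h']].
  pose proof (folded_pow_neq lam x m H) as hm.
  pose proof (Rabs_pos_lt _ hm) as hm'.
  exists (Rmin d (d' * Rabs (lam ^ m))); split; [apply Rmin_pos; nra|].
  intros s hs j hj; pose proof (Rmin_l d (d' * Rabs (lam ^ m))).
  pose proof (Rmin_r d (d' * Rabs (lam ^ m))).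
  destruct (Nat.eq_dec j m) as [->|hne]; [|apply IH; [lra|lia]].
  apply h'.
  replace (s / lam ^ m - t / lam ^ m) with ((s - t) / lam ^ m) by (field; exact hm).
  unfold Rdiv; rewrite Rabs_mult, Rabs_inv; split.
  - apply Rmult_lt_0_compat; [lra|apply Rinv_0_lt_compat, hm'].
  - apply Rmult_lt_reg_r with (Rabs (lam ^ m)); [exact hm'|].
    rewrite Rmult_assoc, Rinv_l by lra; lra. }
destruct (hd N) as [d [hd0 h]].
exists (Rmin d 1); split; [apply Rmin_pos; lra|].
intros s hs i ei; pose proof (Rmin_l d 1); pose proof (Rmin_r d 1).
destruct (proj1 (marks_range _ _ _ M s) (ex_intro _ i ei)) as [j hj].
destruct (Nat.lt_ge_cases j N) as [hjN|hjN].
- apply (h s ltac:(lra) j hjN hj).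
- assert (0 < x (s / lam ^ j)); [|lra].
  apply hpos, hN; [exact hjN|].
  replace s with ((s - t) + t) by ring.
  eapply Rle_trans; [apply Rabs_triang|lra].
Qed.

(** A bounded increasing sequence of marks would accumulate at its supremum, against isolation. *)
Lemma marks_unbounded_above (lam : R) (x : R -> R) (e : Z -> R) (t : R) :
  folded lam x -> marks lam x e -> exists i, t < e i.
Proof.
intros H M; apply NNPP; intros hn.
destruct (completeness (fun y => exists i, e i = y)) as [l [hl1 hl2]].
{ exists t; intros y [i <-]; apply Rnot_lt_le; intros hlt; apply hn; exists i; exact hlt. }
{ exists (e 0%Z), 0%Z; reflexivity. }
destruct (marks_isolated lam x e l H M) as [d [hd h]].
assert (hi : exists i, l - d < e i).
{ apply NNPP; intros hn'; assert (l <= l - d); [|lra].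
  apply hl2; intros y [i <-]; apply Rnot_lt_le; intros hlt; apply hn'; exists i; exact hlt. }
destruct hi as [i hi]; pose proof (marks_lt _ _ _ M i) as hlt.
assert (e (i + 1)%Z <= l) by (apply hl1; exists (i + 1)%Z; reflexivity).
apply (h (e i)) with i; [|reflexivity].
rewrite Rabs_left by lra; lra.
Qed.

Lemma marks_unbounded_below (lam : R) (x : R -> R) (e : Z -> R) (t : R) :
  folded lam x -> marks lam x e -> exists i, e i < t.
Proof.
intros H M; apply NNPP; intros hn.
destruct (completeness (fun y => exists i, - e i = y)) as [l [hl1 hl2]].
{ exists (- t); intros y [i <-]; apply Ropp_le_contravar, Rnot_lt_le; intros hlt.
  apply hn; exists i; exact hlt. }
{ exists (- e 0%Z), 0%Z; reflexivity. }
destruct (marks_isolated lam x e (- l) H M) as [d [hd h]].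
assert (hi : exists i, l - d < - e i).
{ apply NNPP; intros hn'; assert (l <= l - d); [|lra].
  apply hl2; intros y [i <-]; apply Rnot_lt_le; intros hlt; apply hn'; exists i; exact hlt. }
destruct hi as [i hi]; pose proof (marks_lt _ _ _ M (i - 1)%Z) as hlt.
replace (i - 1 + 1)%Z with i in hlt by lia.
assert (- e (i - 1)%Z <= l) by (apply hl1; exists (i - 1)%Z; reflexivity).
apply (h (e i)) with i; [|reflexivity].
rewrite Rabs_pos_eq by lra; lra.
Qed.

Lemma discrete_crossing (P : Z -> Prop) (i j : Z) : (i <= j)%Z -> P i -> ~ P j ->
  exists k, P k /\ ~ P (k + 1)%Z.
Proof.
intros hij hi hj; apply NNPP; intros hn; apply hj.
assert (h : forall n : nat, P (i + Z.of_nat n)%Z).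
{ induction n as [|n IH]; [replace (i + Z.of_nat 0)%Z with i by lia; exact hi|].
  apply NNPP; intros hn'; apply hn; exists (i + Z.of_nat n)%Z; split; [exact IH|].
  replace (i + Z.of_nat n + 1)%Z with (i + Z.of_nat (S n))%Z by lia; exact hn'. }
specialize (h (Z.to_nat (j - i))).
replace (i + Z.of_nat (Z.to_nat (j - i)))%Z with j in h by lia; exact h.
Qed.

(** * One-sided germs and paths *)

(** The sign of [eta] selects the side of [u]. Its size is kept so that multiplication by [lam] acts
    on [u] and [eta] alike, with the same [h]. *)
Definition germ_in (e : Z -> R) (u eta : R) (i : Z) : Prop :=
  exists d, 0 < d /\ forall h, 0 < h < d -> e i < u + eta * h < e (i + 1)%Z.

Lemma germ_in_exists (lam : R) (x : R -> R) (e : Z -> R) (u eta : R) :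
  folded lam x -> marks lam x e -> eta <> 0 -> exists i, germ_in e u eta i.
Proof.
intros H M heta.
destruct (marks_unbounded_below lam x e u H M) as [i hi].
destruct (marks_unbounded_above lam x e u H M) as [j hj].
assert (hij : (i <= j)%Z).
{ destruct (Z.le_gt_cases i j) as [h|h]; [exact h|].
  pose proof (marks_mono e (marks_lt _ _ _ M) j i h); lra. }
(* The two sides differ in strictness: an arc holding the left germ starts strictly before [u], one
   holding the right germ may start at [u]. *)
destruct (Rdichotomy _ _ heta) as [hneg|hpos].
- destruct (discrete_crossing (fun i => e i < u) i j hij hi) as [k [h1 h2]]; [lra|].
  exists k, ((u - e k) / - eta); split; [apply Rdiv_lt_0_compat; lra|].
  intros h hh.
  assert (h * - eta < u - e k) by (apply Rlt_div_r; lra).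
  assert (0 < h * - eta) by (apply Rmult_lt_0_compat; lra).
  lra.
- destruct (discrete_crossing (fun i => e i <= u) i j hij) as [k [h1 h2]]; [lra|lra|].
  exists k, ((e (k + 1)%Z - u) / eta); split; [apply Rdiv_lt_0_compat; lra|].
  intros h hh.
  assert (h * eta < e (k + 1)%Z - u) by (apply Rlt_div_r; lra).
  assert (0 < h * eta) by (apply Rmult_lt_0_compat; lra).
  lra.
Qed.

(** Marks are mapped to marks, so the image of arc [i] is bounded by marks. It contains an interior
    point of arc [j], hence all of arc [j]. *)
Lemma germ_in_arrow (lam : R) (x : R -> R) (e : Z -> R) (u eta : R) (i j : Z) :
  folded lam x -> marks lam x e -> germ_in e u eta i -> germ_in e (lam * u) (lam * eta) j ->
  forall s, e j <= s <= e (j + 1)%Z -> e i <= s / lam <= e (i + 1)%Z.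
Proof.
intros H M [d1 [hd1 h1]] [d2 [hd2 h2]] s hs.
pose proof (fold_lam _ _ H) as hl.
pose proof (marks_lt _ _ _ M) as hlt.
assert (image : forall m, exists m', e m' = lam * e m).
{ intros m; apply (marks_range _ _ _ M).
  destruct (proj1 (marks_range _ _ _ M (e m)) (ex_intro _ m eq_refl)) as [k hk].
  exists (S k); rewrite <- hk; f_equal; cbn [pow]; field.
  split; [apply (folded_pow_neq lam x), H|lra]. }
destruct (image i) as [m1 e1], (image (i + 1)%Z) as [m2 e2].
pose (h := Rmin d1 d2 / 2).
assert (hh : 0 < h /\ h < d1 /\ h < d2).
{ pose proof (Rmin_l d1 d2); pose proof (Rmin_r d1 d2).
  assert (0 < Rmin d1 d2) by (apply Rmin_pos; lra); unfold h; lra. }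
specialize (h1 h ltac:(lra)); specialize (h2 h ltac:(lra)).
pose (w := lam * u + lam * eta * h).
(* The factor [lam] is negative, so the image of the right end is the lower one. *)
assert (hw : e m2 < w < e m1) by (rewrite e1, e2; unfold w; nra).
fold w in h2.
assert (hm2 : (m2 <= j)%Z).
{ destruct (Z.le_gt_cases m2 j) as [hle|hgt]; [exact hle|].
  pose proof (marks_mono_le e hlt (j + 1) m2 ltac:(lia)); lra. }
assert (hm1 : (j + 1 <= m1)%Z).
{ destruct (Z.le_gt_cases (j + 1) m1) as [hle|hgt]; [exact hle|].
  pose proof (marks_mono_le e hlt m1 j ltac:(lia)); lra. }
pose proof (marks_mono_le e hlt _ _ hm2); pose proof (marks_mono_le e hlt _ _ hm1).
assert (es : s = lam * (s / lam)) by (field; lra).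
split; apply Rnot_lt_le; intros hn; nra.
Qed.

Lemma marks_constant_sign (lam : R) (x : R -> R) (e : Z -> R) (i : Z) (u v c : R) :
  folded lam x -> marks lam x e ->
  e i < u < e (i + 1)%Z -> e i < v < e (i + 1)%Z -> 0 < c * x u -> 0 < c * x v.
Proof.
intros H M hu hv hc; apply Rnot_le_lt; intros hn.
assert (hz : exists w, e i < w < e (i + 1)%Z /\ x w = 0).
{ assert (hcv : 0 <= c * x u /\ c * x v <= 0) by lra.
  destruct (Rle_or_lt u v) as [huv|huv].
  - destruct (IVT_range x u v 0 huv) as [w [hw ew]].
    + intros; apply (fold_cont _ _ H).
    + destruct (Rle_or_lt 0 c); nra.
    + exists w; split; [lra|exact ew].
  - destruct (IVT_range x v u 0) as [w [hw ew]]; [lra| | |].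
    + intros; apply (fold_cont _ _ H).
    + destruct (Rle_or_lt 0 c); nra.
    + exists w; split; [lra|exact ew]. }
destruct hz as [w [hw ew]].
destruct (proj2 (marks_range _ _ _ M w)) as [k ek].
{ exists O; cbn [pow]; rewrite Rdiv_1_r; exact ew. }
pose proof (marks_lt _ _ _ M) as hlt.
destruct (Z.le_gt_cases k i) as [h|h].
- pose proof (marks_mono_le e hlt k i h); lra.
- pose proof (marks_mono_le e hlt (i + 1) k ltac:(lia)); lra.
Qed.

(** A single direction [eta] has to serve at all times. Off the axis either side will do by
    continuity; at a zero after the first, the essential condition prescribes the sign on both
    sides; at the first zero [x] changes sign, and the symbol there selects the side. *)
Lemma line_essential_path (lam : R) (x : R -> R) (e : Z -> R) (p : Z -> symbol) :
  folded lam x -> marks lam x e -> line_essential lam x p -> line_path lam x e p.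
Proof.
intros H M [t [hw he]].
pose proof (fold_lam _ _ H) as hl; assert (hl0 : lam <> 0) by lra.
assert (hside : exists eta, eta <> 0 /\ forall n, exists d, 0 < d /\
  forall h, 0 < h < d -> strict_sign (p n) (x (powerRZ lam n * (t + eta * h)))).
{ assert (hreg : forall n eta, x (powerRZ lam n * t) <> 0 -> exists d, 0 < d /\
    forall h, 0 < h < d -> strict_sign (p n) (x (powerRZ lam n * (t + eta * h)))).
  { intros n eta hx.
    destruct (continuity_pt_pos x (powerRZ lam n * t) (symbol_sign (p n)))
      as [d [hd h]].
    - apply (fold_cont _ _ H).
    - specialize (hw n); apply weak_signE in hw.
      destruct (p n); cbn in *; lra.
    - pose (k := Rabs (powerRZ lam n * eta) + 1).
      assert (hk : 0 < k) by (pose proof (Rabs_pos (powerRZ lam n * eta)); unfold k; lra).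
      exists (d / k); split; [apply Rdiv_lt_0_compat; lra|].
      intros y hy; apply strict_signE, h.
      replace (powerRZ lam n * (t + eta * y) - powerRZ lam n * t)
        with (powerRZ lam n * eta * y) by ring.
      rewrite Rabs_mult, (Rabs_pos_eq y) by lra.
      assert (y * k < d) by (apply Rlt_div_r; lra).
      unfold k in *; nra. }
  destruct (classic (exists k, x (powerRZ lam k * t) = 0)) as [[k0 hk0]|hn].
  (* A first zero exists because far in the past the orbit is in the neighbourhood of 0 where [x] is
     positive. *)
  - assert (hk : exists k, x (powerRZ lam k * t) = 0 /\
      forall n, (n < k)%Z -> x (powerRZ lam n * t) <> 0).
    { destruct (fold_pos _ _ H) as [r [hr hpos]].
      destruct (div_pow_small lam r (Rabs t) hl hr) as [N hN].
      assert (hneg : forall n, (n <= - Z.of_nat N)%Z -> x (powerRZ lam n * t) <> 0).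
      { intros n hnN; assert (0 < x (powerRZ lam n * t)); [|lra].
        apply hpos.
        replace (powerRZ lam n * t) with (t / lam ^ (Z.to_nat (- n))).
        - apply hN; [lia|lra].
        - replace t with (powerRZ lam 0 * t) at 1 by (cbn; ring).
          rewrite powerRZ_sub_nat by exact hl0; do 2 f_equal; lia. }
      destruct (discrete_crossing
        (fun m => forall n, (n <= m)%Z -> x (powerRZ lam n * t) <> 0)
        (Z.min k0 (- Z.of_nat N)) k0) as [k [h1 h2]].
      - lia.
      - intros n hn; apply hneg; lia.
      - intros hn; apply (hn k0); [lia|exact hk0].
      - exists (k + 1)%Z; split.
        + apply NNPP; intros hn; apply h2; intros n hnk.
          destruct (Z.eq_dec n (k + 1)) as [->|hne]; [exact hn|apply h1; lia].
        + intros n hnk; apply h1; lia. }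
    destruct hk as [k [hk hfirst]].
    pose proof (folded_powerRZ_neq lam x k H) as hmk.
    destruct (fold_cross _ _ H _ hk) as [c [d [hd hc]]].
    { intros j hj; rewrite powerRZ_sub_nat by exact hl0; apply hfirst; lia. }
    (* With this choice [c * (powerRZ lam k * eta)] is a square times the sign of [p k], so
       [fold_cross] along the germ gives exactly the required sign. *)
    pose (eta := c * powerRZ lam k * symbol_sign (p k)).
    assert (hcne : c <> 0).
    { intros ->; specialize (hc (powerRZ lam k * t + d / 2)).
      replace (powerRZ lam k * t + d / 2 - powerRZ lam k * t) with (d / 2) in hc by ring.
      rewrite Rabs_pos_eq in hc by lra; lra. }
    assert (hsne : symbol_sign (p k) <> 0) by (destruct (p k); cbn; lra).
    assert (heta : eta <> 0) by (unfold eta; repeat apply Rmult_integral_contrapositive_currified; assumption).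
    exists eta; split; [exact heta|].
    intros n; destruct (Req_dec (x (powerRZ lam n * t)) 0) as [hx|hx]; [|apply hreg, hx].
    destruct (Z.lt_total n k) as [hnk|[->|hkn]].
    + contradiction (hfirst n hnk).
    + assert (hpe : 0 < Rabs (powerRZ lam k * eta)).
      { apply Rabs_pos_lt, Rmult_integral_contrapositive_currified; assumption. }
      exists (d / Rabs (powerRZ lam k * eta)); split; [apply Rdiv_lt_0_compat; lra|].
      intros y hy.
      assert (hy' : y * Rabs (powerRZ lam k * eta) < d) by (apply Rlt_div_r; lra).
      specialize (hc (powerRZ lam k * (t + eta * y))).
      replace (powerRZ lam k * (t + eta * y) - powerRZ lam k * t)
        with (powerRZ lam k * eta * y) in hc by ring.
      rewrite Rabs_mult, (Rabs_pos_eq y) in hc by lra.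
      specialize (hc ltac:(split; [apply Rmult_lt_0_compat|]; lra)).
      apply strict_signE.
      set (X := x (powerRZ lam k * (t + eta * y))) in *; clearbody X; unfold eta in hc.
      replace (c * (powerRZ lam k * (c * powerRZ lam k * symbol_sign (p k)) * y * X))
        with ((c * powerRZ lam k) ^ 2 * y * (symbol_sign (p k) * X)) in hc by ring.
      apply Rmult_lt_reg_l with ((c * powerRZ lam k) ^ 2 * y); [|rewrite Rmult_0_r; exact hc].
      apply Rmult_lt_0_compat; [|lra].
      apply pow2_gt_0, Rmult_integral_contrapositive_currified; assumption.
    + destruct (he k n hk hfirst hkn hx) as [d' [hd' h']].
      assert (hpe : 0 < Rabs eta) by (apply Rabs_pos_lt, heta).
      exists (d' / Rabs eta); split; [apply Rdiv_lt_0_compat; lra|].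
      intros y hy; apply h'.
      assert (hy' : y * Rabs eta < d') by (apply Rlt_div_r; lra).
      replace (t + eta * y - t) with (eta * y) by ring.
      rewrite Rabs_mult, (Rabs_pos_eq y) by lra.
      split; [apply Rmult_lt_0_compat; lra|lra].
  - exists 1; split; [lra|]; intros n; apply hreg.
    intros hx; apply hn; exists n; exact hx. }
destruct hside as [eta [heta hside]].
assert (hB : forall n, exists i, germ_in e (powerRZ lam n * t) (powerRZ lam n * eta) i).
{ intros n; apply (germ_in_exists lam x); [exact H|exact M|].
  apply Rmult_integral_contrapositive_currified; [apply (folded_powerRZ_neq lam x), H|exact heta]. }
pose (B := fun n => proj1_sig (constructive_indefinite_description _ (hB n))).
assert (hBg : forall n, germ_in e (powerRZ lam n * t) (powerRZ lam n * eta) (B n)).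
{ intros n; exact (proj2_sig (constructive_indefinite_description _ (hB n))). }
exists B; split.
- intros n; apply (germ_in_arrow lam x e (powerRZ lam n * t) (powerRZ lam n * eta));
    [exact H|exact M|apply hBg|].
  rewrite <- !Rmult_assoc, <- !powerRZ_succ by exact hl0; apply hBg.
- intros n s hs; apply strict_signE.
  destruct (hBg n) as [d1 [hd1 h1]], (hside n) as [d2 [hd2 h2]].
  pose (h := Rmin d1 d2 / 2).
  assert (hh : 0 < h /\ h < d1 /\ h < d2).
  { pose proof (Rmin_l d1 d2); pose proof (Rmin_r d1 d2).
    assert (0 < Rmin d1 d2) by (apply Rmin_pos; lra); unfold h; lra. }
  specialize (h1 h ltac:(lra)); specialize (h2 h ltac:(lra)); apply strict_signE in h2.
  apply (marks_constant_sign lam x e (B n) (powerRZ lam n * (t + eta * h))); trivial.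
  replace (powerRZ lam n * (t + eta * h)) with (powerRZ lam n * t + powerRZ lam n * eta * h)
    by ring; exact h1.
Qed.

Lemma scaled_interval (m A B t : R) : m <> 0 -> A <= B ->
  (A <= m * t <= B <-> Rmin (A / m) (B / m) <= t <= Rmax (A / m) (B / m)).
Proof.
intros hm hAB.
assert (eA : A = m * (A / m)) by (field; exact hm).
assert (eB : B = m * (B / m)) by (field; exact hm).
set (u := A / m) in *; set (v := B / m) in *; clearbody u v; subst A B.
destruct (Rdichotomy _ _ hm) as [hneg|hpos].
- assert (v <= u) by nra.
  rewrite Rmin_right, Rmax_left by lra; split; nra.
- assert (u <= v) by nra.
  rewrite Rmin_left, Rmax_right by lra; split; nra.
Qed.

(** The condition at time [n + 1] implies the one at time [n], so the intervals of candidates for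
    [t] have a common point. An iterate of it may be an end point of its arc, so signs are sampled
    at interior points nearby: weak signs follow by continuity, and at a later zero [fold_turn]
    spreads the sampled sign to both sides. *)
Lemma line_path_essential (lam : R) (x : R -> R) (e : Z -> R) (p : Z -> symbol) :
  folded lam x -> marks lam x e -> line_path lam x e p -> line_essential lam x p.
Proof.
intros H M [B [harr hsign]].
pose proof (fold_lam _ _ H) as hl; assert (hl0 : lam <> 0) by lra.
pose proof (marks_lt _ _ _ M) as hlt.
pose (hit := fun n t => e (B n) <= powerRZ lam n * t <= e (B n + 1)%Z).
assert (hback : forall n t, hit (n + 1)%Z t -> hit n t).
{ intros n t ht; specialize (harr n _ ht).
  replace (powerRZ lam (n + 1) * t / lam) with (powerRZ lam n * t) in harr; [exact harr|].
  rewrite powerRZ_succ by exact hl0; field; exact hl0. }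
assert (hback' : forall (m : nat) n t, hit (n + Z.of_nat m)%Z t -> hit n t).
{ induction m as [|m IH]; intros n t ht.
  - rewrite Z.add_0_r in ht; exact ht.
  - apply IH, hback; replace (n + Z.of_nat m + 1)%Z with (n + Z.of_nat (S m))%Z by lia.
    exact ht. }
pose (lo := fun n => Rmin (e (B n) / powerRZ lam n) (e (B n + 1)%Z / powerRZ lam n)).
pose (hi := fun n => Rmax (e (B n) / powerRZ lam n) (e (B n + 1)%Z / powerRZ lam n)).
assert (hitE : forall n t, hit n t <-> lo n <= t <= hi n).
{ intros n t; apply scaled_interval; [apply (folded_powerRZ_neq lam x), H|].
  apply Rlt_le, hlt. }
assert (hlohi : forall n, lo n <= hi n) by (intros n; apply Rminmax).
assert (hcross : forall n m, lo n <= hi m).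
{ intros n m; destruct (Z.le_ge_cases n m) as [hnm|hnm].
  - assert (h : hit n (hi m)).
    { apply (hback' (Z.to_nat (m - n))).
      replace (n + Z.of_nat (Z.to_nat (m - n)))%Z with m by lia.
      apply hitE; split; [apply hlohi|apply Rle_refl]. }
    apply hitE in h; lra.
  - assert (h : hit m (lo n)).
    { apply (hback' (Z.to_nat (n - m))).
      replace (m + Z.of_nat (Z.to_nat (n - m)))%Z with n by lia.
      apply hitE; split; [apply Rle_refl|apply hlohi]. }
    apply hitE in h; lra. }
destruct (completeness (fun y => exists n, lo n = y)) as [t [ht1 ht2]].
{ exists (hi 0%Z); intros y [n <-]; apply hcross. }
{ exists (lo 0%Z), 0%Z; reflexivity. }
assert (ht : forall n, hit n t).
{ intros n; apply hitE; split; [apply ht1; exists n; reflexivity|].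
  apply ht2; intros y [m <-]; apply hcross. }
assert (hnear : forall n d, 0 < d -> exists s, 0 < Rabs (s - powerRZ lam n * t) < d /\
  e (B n) < s < e (B n + 1)%Z).
{ intros n d hd; specialize (ht n); specialize (hlt (B n)); unfold hit in ht.
  set (u := powerRZ lam n * t) in *.
  destruct (Rlt_or_le u (e (B n + 1)%Z)) as [hu|hu].
  - pose proof (Rmin_l d (e (B n + 1)%Z - u)); pose proof (Rmin_r d (e (B n + 1)%Z - u)).
    assert (0 < Rmin d (e (B n + 1)%Z - u)) by (apply Rmin_pos; lra).
    exists (u + Rmin d (e (B n + 1)%Z - u) / 2).
    rewrite Rabs_pos_eq by lra; lra.
  - pose proof (Rmin_l d (u - e (B n))); pose proof (Rmin_r d (u - e (B n))).
    assert (0 < Rmin d (u - e (B n))) by (apply Rmin_pos; lra).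
    exists (u - Rmin d (u - e (B n)) / 2).
    rewrite Rabs_left by lra; lra. }
exists t; split.
- intros n; apply weak_signE, Rnot_lt_le; intros hn.
  destruct (continuity_pt_pos x (powerRZ lam n * t) (- symbol_sign (p n)))
    as [d [hd h]]; [apply (fold_cont _ _ H)|lra|].
  destruct (hnear n d hd) as [s [hs1 hs2]].
  specialize (h s (proj2 hs1)); specialize (hsign n s hs2); apply strict_signE in hsign; lra.
- intros k l hk _ hkl hxl.
  destruct (fold_turn _ _ H (powerRZ lam l * t) (Z.to_nat (l - k)) hxl) as [c [d [hd h]]].
  { lia. }
  { rewrite powerRZ_sub_nat by exact hl0.
    replace (l - Z.of_nat (Z.to_nat (l - k)))%Z with k by lia; exact hk. }
  destruct (hnear l d hd) as [s [hs1 hs2]].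
  specialize (hsign l s hs2); apply strict_signE in hsign.
  pose proof (h s hs1) as hcs.
  pose proof (Rabs_pos_lt _ (folded_powerRZ_neq lam x l H)) as hm.
  exists (d / Rabs (powerRZ lam l)); split; [apply Rdiv_lt_0_compat; lra|].
  intros r hr; apply strict_signE.
  apply symbol_sign_agree with c (x s); [exact hsign|exact hcs|apply h].
  rewrite <- Rmult_minus_distr_l, Rabs_mult; split.
  + apply Rmult_lt_0_compat; lra.
  + rewrite Rmult_comm; apply Rlt_div_r; lra.
Qed.

(** * The unstable curve of the Lozi map *)

(** From [b + 2 < 1.42 * a] and [a < 2] follows [a - b > 2 - 0.42 * a > 1]. *)
Lemma in_S_bounds (a b : R) : in_S a b -> 0 < b /\ 1 + b < a.
Proof.
intros [hb [h1 [_ h2]]]; split; [exact hb|].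
pose proof (sqrt_def 2 ltac:(lra)) as hs.
pose proof (sqrt_pos 2) as hp.
assert (hs1 : sqrt 2 < 1.42) by (apply Rnot_le_lt; intros hn; nra).
assert (hs2 : 1.41 < sqrt 2) by (apply Rnot_le_lt; intros hn; nra).
nra.
Qed.

(** The positive root of [mu ^ 2 + a * mu - b], the characteristic polynomial of the linear part of
    [lozi] on the right half-plane. The roots add up to [- a], which gives [unstable_ev]. *)
Definition stable_ev (a b : R) : R := (sqrt (a ^ 2 + 4 * b) - a) / 2.

Definition unstable_ev (a b : R) : R := - (a + stable_ev a b).

Lemma stable_ev_root (a b : R) : 0 < b -> stable_ev a b ^ 2 + a * stable_ev a b = b.
Proof.
intros hb; unfold stable_ev.
pose proof (sqrt_def (a ^ 2 + 4 * b) ltac:(nra)) as hs; nra.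
Qed.

Lemma stable_ev_bounds (a b : R) : 0 < b -> 1 + b < a ->
  0 < stable_ev a b < 1 /\ stable_ev a b <= b.
Proof.
intros hb ha; pose proof (stable_ev_root a b hb) as hr.
assert (0 < stable_ev a b).
{ unfold stable_ev; assert (a < sqrt (a ^ 2 + 4 * b)); [|lra].
  rewrite <- (sqrt_pow2 a) at 1 by lra; apply sqrt_lt_1; nra. }
split; [split; [assumption|]|]; nra.
Qed.

Lemma unstable_ev_lt (a b : R) : 0 < b -> 1 + b < a -> unstable_ev a b < -1.
Proof. intros hb ha; pose proof (stable_ev_bounds a b hb ha); unfold unstable_ev; lra. Qed.

(** An eigenvector (x, y) for [unstable_ev] satisfies y = (unstable_ev + a) x, so the slope is minus
    the stable eigenvalue. The parameter is the horizontal displacement from the fixed point. *)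
Definition eigenline (a b t : R) : plane :=
  (1 / (1 + a - b) + t, b / (1 + a - b) - stable_ev a b * t).

Lemma lozi_eigenline (a b t : R) : 0 < b -> 1 + b < a -> - (1 / (1 + a - b)) <= t ->
  lozi a b (eigenline a b t) = eigenline a b (unstable_ev a b * t).
Proof.
intros hb ha ht; unfold lozi, eigenline; cbn [fst snd].
rewrite Rabs_pos_eq by lra; unfold unstable_ev.
pose proof (stable_ev_root a b hb) as hr; f_equal.
- field; lra.
- replace (stable_ev a b * (- (a + stable_ev a b) * t))
    with (- (stable_ev a b ^ 2 + a * stable_ev a b) * t) by ring.
  rewrite hr; field; lra.
Qed.

Definition stage (a b : R) (n : nat) (t : R) : plane :=
  Nat.iter n (lozi a b) (eigenline a b (t / unstable_ev a b ^ n)).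

(** The bound is the abscissa of the fixed point: below it the eigenline stays in the right
    half-plane, where the map is affine. Any such [n] yields the same point, by
    [unstable_curve_stage]. *)
Definition level (a b t : R) : nat :=
  epsilon (inhabits O) (fun n => Rabs (t / unstable_ev a b ^ n) < 1 / (1 + a - b)).

Definition unstable_curve (a b t : R) : plane := stage a b (level a b t) t.

Lemma stage_exists (a b K : R) : 0 < b -> 1 + b < a ->
  exists n, forall t, Rabs t <= K -> Rabs (t / unstable_ev a b ^ n) < 1 / (1 + a - b).
Proof.
intros hb ha.
destruct (div_pow_small (unstable_ev a b) (1 / (1 + a - b)) K) as [N hN].
- apply unstable_ev_lt; assumption.
- apply Rdiv_lt_0_compat; lra.
- exists N; intros t ht; apply hN; [apply le_n|exact ht].
Qed.

Lemma stage_add (a b t : R) (n k : nat) : 0 < b -> 1 + b < a ->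
  Rabs (t / unstable_ev a b ^ n) < 1 / (1 + a - b) ->
  Rabs (t / unstable_ev a b ^ (n + k)) < 1 / (1 + a - b) /\
  stage a b (n + k) t = stage a b n t.
Proof.
intros hb ha hn; pose proof (unstable_ev_lt a b hb ha) as hl.
induction k as [|k [IH1 IH2]]; [rewrite Nat.add_0_r; split; trivial|].
rewrite Nat.add_succ_r; set (m := (n + k)%nat) in *.
assert (hm : unstable_ev a b ^ m <> 0) by (apply pow_nonzero; lra).
assert (e : t / unstable_ev a b ^ m = unstable_ev a b * (t / unstable_ev a b ^ S m)).
{ cbn [pow]; field; split; [exact hm|lra]. }
assert (h1 : Rabs (t / unstable_ev a b ^ S m) < 1 / (1 + a - b)).
{ rewrite e, Rabs_mult in IH1; rewrite (Rabs_left (unstable_ev a b)) in IH1 by lra.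
  pose proof (Rabs_pos (t / unstable_ev a b ^ S m)); nra. }
split; [exact h1|]; rewrite <- IH2; unfold stage.
rewrite Nat.iter_succ_r; f_equal; rewrite e; apply lozi_eigenline; trivial.
apply Rabs_def2 in h1; lra.
Qed.

Lemma unstable_curve_stage (a b t : R) (n : nat) : 0 < b -> 1 + b < a ->
  Rabs (t / unstable_ev a b ^ n) < 1 / (1 + a - b) -> unstable_curve a b t = stage a b n t.
Proof.
intros hb ha hn; unfold unstable_curve.
assert (hm : Rabs (t / unstable_ev a b ^ level a b t) < 1 / (1 + a - b)).
{ unfold level; apply epsilon_spec; exists n; exact hn. }
set (m := level a b t) in *; clearbody m.
destruct (Nat.le_ge_cases n m) as [h|h].
- rewrite <- (proj2 (stage_add a b t n (m - n) hb ha hn)).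
  replace (n + (m - n))%nat with m by lia; reflexivity.
- rewrite <- (proj2 (stage_add a b t m (n - m) hb ha hm)).
  replace (m + (n - m))%nat with n by lia; reflexivity.
Qed.

Lemma unstable_curve_local (a b t : R) : 0 < b -> 1 + b < a ->
  Rabs t < 1 / (1 + a - b) -> unstable_curve a b t = eigenline a b t.
Proof.
intros hb ha ht; rewrite (unstable_curve_stage a b t 0 hb ha).
- unfold stage; cbn; rewrite Rdiv_1_r; reflexivity.
- cbn [pow]; rewrite Rdiv_1_r; exact ht.
Qed.

Lemma unstable_curve_lozi (a b t : R) : 0 < b -> 1 + b < a ->
  unstable_curve a b (unstable_ev a b * t) = lozi a b (unstable_curve a b t).
Proof.
intros hb ha; pose proof (unstable_ev_lt a b hb ha) as hl.
destruct (stage_exists a b (Rabs t) hb ha) as [n hn]; specialize (hn t (Rle_refl _)).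
assert (e : unstable_ev a b * t / unstable_ev a b ^ S n = t / unstable_ev a b ^ n).
{ cbn [pow]; field; split; [apply pow_nonzero|]; lra. }
rewrite (unstable_curve_stage a b t n hb ha hn).
rewrite (unstable_curve_stage a b _ (S n) hb ha) by (rewrite e; exact hn).
unfold stage; rewrite e; reflexivity.
Qed.

Lemma unstable_curve_lozi_inv (a b t : R) : 0 < b -> 1 + b < a ->
  unstable_curve a b (t / unstable_ev a b) = lozi_inv a b (unstable_curve a b t).
Proof.
intros hb ha; pose proof (unstable_ev_lt a b hb ha) as hl.
replace t with (unstable_ev a b * (t / unstable_ev a b)) at 2 by (field; lra).
rewrite unstable_curve_lozi, loziK by lra; reflexivity.
Qed.

Lemma unstable_curve_iter (a b t : R) (n : Z) : 0 < b -> 1 + b < a ->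
  lozi_iter a b n (unstable_curve a b t) = unstable_curve a b (powerRZ (unstable_ev a b) n * t).
Proof.
intros hb ha; pose proof (unstable_ev_lt a b hb ha) as hl.
destruct n as [|k|k]; cbn [lozi_iter powerRZ].
- rewrite Rmult_1_l; reflexivity.
- induction (Pos.to_nat k) as [|m IH]; cbn [Nat.iter nat_rect pow].
  + rewrite Rmult_1_l; reflexivity.
  + change (lozi a b (Nat.iter m (lozi a b) (unstable_curve a b t)) =
      unstable_curve a b (unstable_ev a b * unstable_ev a b ^ m * t)).
    rewrite IH, <- unstable_curve_lozi, Rmult_assoc by assumption; reflexivity.
- induction (Pos.to_nat k) as [|m IH]; cbn [Nat.iter nat_rect pow].
  + rewrite Rinv_1, Rmult_1_l; reflexivity.
  + change (lozi_inv a b (Nat.iter m (lozi_inv a b) (unstable_curve a b t)) =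
      unstable_curve a b (/ (unstable_ev a b * unstable_ev a b ^ m) * t)).
    rewrite IH, <- unstable_curve_lozi_inv by assumption; f_equal; field.
    split; [apply pow_nonzero|]; lra.
Qed.

Lemma lozi_lipschitz (a b : R) (P Q : plane) : 0 < b -> 0 < a ->
  dist1 (lozi a b P) (lozi a b Q) <= (1 + a + b) * dist1 P Q.
Proof.
intros hb ha; unfold dist1, lozi; cbn [fst snd].
replace (b * fst P - b * fst Q) with (b * (fst P - fst Q)) by ring.
rewrite Rabs_mult, (Rabs_pos_eq b) by lra.
pose proof (Rabs_triang_inv2 (fst P) (fst Q)) as h.
assert (h2 : Rabs (1 + snd P - a * Rabs (fst P) - (1 + snd Q - a * Rabs (fst Q)))
  <= Rabs (snd P - snd Q) + a * Rabs (fst P - fst Q)).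
{ replace (1 + snd P - a * Rabs (fst P) - (1 + snd Q - a * Rabs (fst Q)))
    with ((snd P - snd Q) + - (a * (Rabs (fst P) - Rabs (fst Q)))) by ring.
  eapply Rle_trans; [apply Rabs_triang|].
  rewrite Rabs_Ropp, Rabs_mult, (Rabs_pos_eq a) by lra; nra. }
pose proof (Rabs_pos (fst P - fst Q)); pose proof (Rabs_pos (snd P - snd Q)); nra.
Qed.

Lemma unstable_curve_cont (a b t : R) : 0 < b -> 1 + b < a ->
  curve_cont (unstable_curve a b) t.
Proof.
intros hb ha eps heps; pose proof (unstable_ev_lt a b hb ha) as hl.
pose proof (stable_ev_bounds a b hb ha) as hs.
destruct (stage_exists a b (Rabs t + 1) hb ha) as [n hn].
assert (hlip : forall (m : nat) P Q, dist1 (Nat.iter m (lozi a b) P) (Nat.iter m (lozi a b) Q)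
  <= (1 + a + b) ^ m * dist1 P Q).
{ induction m as [|m IH]; intros P Q; [cbn; lra|].
  rewrite !Nat.iter_succ; eapply Rle_trans; [apply lozi_lipschitz; lra|].
  cbn [pow]; rewrite Rmult_assoc; apply Rmult_le_compat_l; [lra|apply IH]. }
assert (hpn : 0 < Rabs (unstable_ev a b ^ n)) by (apply Rabs_pos_lt, pow_nonzero; lra).
assert (hK : 0 < (1 + a + b) ^ n) by (apply pow_lt; lra).
pose (K := (1 + a + b) ^ n * (2 / Rabs (unstable_ev a b ^ n))).
assert (hKp : 0 < K) by (apply Rmult_lt_0_compat; [exact hK|apply Rdiv_lt_0_compat; lra]).
exists (Rmin 1 (eps / K)); split.
{ apply Rmin_pos; [lra|apply Rdiv_lt_0_compat; assumption]. }
intros s hs'; pose proof (Rmin_l 1 (eps / K)); pose proof (Rmin_r 1 (eps / K)).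
rewrite (unstable_curve_stage a b s n), (unstable_curve_stage a b t n);
  [|assumption|assumption|apply hn; lra|assumption|assumption|].
2:{ apply hn; replace s with ((s - t) + t) by ring.
    eapply Rle_trans; [apply Rabs_triang|lra]. }
unfold stage; eapply Rle_lt_trans; [apply hlip|].
(* The factor 2 bounds [1 + stable_ev a b], the length of the eigenvector for [dist1]. *)
assert (hd : dist1 (eigenline a b (s / unstable_ev a b ^ n))
    (eigenline a b (t / unstable_ev a b ^ n)) <= 2 / Rabs (unstable_ev a b ^ n) * Rabs (s - t)).
{ unfold dist1, eigenline; cbn [fst snd].
  replace (1 / (1 + a - b) + s / unstable_ev a b ^ n - (1 / (1 + a - b) + t / unstable_ev a b ^ n))
    with ((s - t) * / unstable_ev a b ^ n) by (unfold Rdiv; ring).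
  replace (b / (1 + a - b) - stable_ev a b * (s / unstable_ev a b ^ n) -
      (b / (1 + a - b) - stable_ev a b * (t / unstable_ev a b ^ n)))
    with (- (stable_ev a b * ((s - t) * / unstable_ev a b ^ n))) by (unfold Rdiv; ring).
  rewrite Rabs_Ropp, (Rabs_mult (stable_ev a b)), Rabs_mult, Rabs_inv.
  rewrite (Rabs_pos_eq (stable_ev a b)) by lra.
  assert (0 <= Rabs (s - t) * / Rabs (unstable_ev a b ^ n)).
  { apply Rmult_le_pos; [apply Rabs_pos|apply Rlt_le, Rinv_0_lt_compat, hpn]. }
  unfold Rdiv; nra. }
apply Rle_lt_trans with (K * Rabs (s - t)).
- unfold K; rewrite Rmult_assoc; apply Rmult_le_compat_l; lra.
- rewrite Rmult_comm; apply Rlt_div_r; lra.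
Qed.

Lemma lozi_iter_nat_inj (a b : R) (n : nat) (P Q : plane) : 0 < b ->
  Nat.iter n (lozi a b) P = Nat.iter n (lozi a b) Q -> P = Q.
Proof.
intros hb; induction n as [|n IH]; [trivial|].
rewrite !Nat.iter_succ; intros e; apply IH.
rewrite <- (loziK a b _ ltac:(lra)), e, loziK by lra; reflexivity.
Qed.

Lemma unstable_curve_inj (a b s t : R) : 0 < b -> 1 + b < a ->
  unstable_curve a b s = unstable_curve a b t -> s = t.
Proof.
intros hb ha e; pose proof (unstable_ev_lt a b hb ha) as hl.
destruct (stage_exists a b (Rabs s + Rabs t) hb ha) as [n hn].
pose proof (Rabs_pos s); pose proof (Rabs_pos t).
rewrite (unstable_curve_stage a b s n), (unstable_curve_stage a b t n) in e
  by (try assumption; apply hn; lra).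
apply lozi_iter_nat_inj in e; [|exact hb].
apply (f_equal fst) in e; unfold eigenline in e; cbn [fst] in e.
assert (hp : unstable_ev a b ^ n <> 0) by (apply pow_nonzero; lra).
assert (e' : s / unstable_ev a b ^ n = t / unstable_ev a b ^ n) by lra.
apply (f_equal (fun y => y * unstable_ev a b ^ n)) in e'.
unfold Rdiv in e'; rewrite !Rmult_assoc, Rinv_l, !Rmult_1_r in e' by exact hp; exact e'.
Qed.

Lemma filterlim_dist1 (f : nat -> plane) (P : plane) :
  filterlim f eventually (locally P) <->
  forall eps, 0 < eps -> exists N, forall n, (N <= n)%nat -> dist1 (f n) P < eps.
Proof.
split.
- intros h eps heps.
  destruct (proj1 (filterlim_locally _ _) h (mkposreal (eps / 2) ltac:(lra))) as [N hN]; exists N; intros n hn; destruct (hN n hn) as [h1 h2].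
  unfold dist1; change (Rabs (fst (f n) - fst P) < eps / 2) in h1.
  change (Rabs (snd (f n) - snd P) < eps / 2) in h2; lra.
- intros h; apply (proj2 (filterlim_locally _ _)); intros eps.
  destruct (h eps (cond_pos eps)) as [N hN]; exists N; intros n hn; specialize (hN n hn).
  unfold dist1 in hN.
  pose proof (Rabs_pos (fst (f n) - fst P)); pose proof (Rabs_pos (snd (f n) - snd P)).
  split.
  + change (Rabs (fst (f n) - fst P) < eps); lra.
  + change (Rabs (snd (f n) - snd P) < eps); lra.
Qed.

Lemma continuous_curve_cont (f : R -> plane) (t : R) :
  continuous f t -> curve_cont f t.
Proof.
intros h eps heps; unfold continuous in h.
destruct (proj1 (filterlim_locally _ _) h (mkposreal (eps / 2) ltac:(lra))) as [d hd]; exists d; split; [apply cond_pos|]; intros s hs.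
destruct (hd s hs) as [h1 h2].
unfold dist1; change (Rabs (fst (f s) - fst (f t)) < eps / 2) in h1.
change (Rabs (snd (f s) - snd (f t)) < eps / 2) in h2; lra.
Qed.

(* The left eigenvector for the contracting eigenvalue: it vanishes exactly on the
   unstable line, and is expanded by the inverse map. *)
Definition stable_coord (a b : R) (P : plane) : R :=
  stable_ev a b * (fst P - 1 / (1 + a - b)) + (snd P - b / (1 + a - b)).

Lemma stable_coord_lozi (a b : R) (P : plane) : 0 < b -> 1 + b < a -> 0 <= fst P ->
  stable_coord a b (lozi a b P) = stable_ev a b * stable_coord a b P.
Proof.
intros hb ha hP; unfold stable_coord, lozi; cbn [fst snd].
rewrite Rabs_pos_eq by exact hP.
pose proof (stable_ev_root a b hb) as hr.
assert (e1 : b / (1 + a - b) = b * (1 / (1 + a - b))) by (unfold Rdiv; ring).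
assert (e2 : (1 + a - b) * (1 / (1 + a - b)) = 1) by (field; lra).
rewrite e1; set (X := 1 / (1 + a - b)) in *; clearbody X.
apply Rminus_diag_uniq.
transitivity ((b - (stable_ev a b ^ 2 + a * stable_ev a b)) * (fst P - X) +
  stable_ev a b * (1 - (1 + a - b) * X)); [ring|].
rewrite hr, e2; ring.
Qed.

(** A backward orbit converging to the fixed point ends up in the right half-plane, where each
    backward step divides [stable_coord] by [stable_ev]. Boundedness forces this coordinate to
    vanish, which puts the orbit on the eigenline. *)
Lemma unstable_range (a b : R) (T : plane) : 0 < b -> 1 + b < a ->
  unstable a b T <-> exists t, unstable_curve a b t = T.
Proof.
intros hb ha; pose proof (unstable_ev_lt a b hb ha) as hl.
pose proof (stable_ev_bounds a b hb ha) as hs.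
assert (hr : 0 < 1 / (1 + a - b)) by (apply Rdiv_lt_0_compat; lra).
unfold unstable; rewrite filterlim_dist1; split.
(* The tolerance is the abscissa of the fixed point, so from [N] on the first coordinate is
   positive. *)
- intros h; destruct (h _ hr) as [N hN].
  pose (Q := fun n => lozi_iter a b (- Z.of_nat n) T).
  assert (hQn : forall n, Q n = Nat.iter n (lozi_inv a b) T).
  { intros [|n]; [reflexivity|]; unfold Q; cbn [Z.of_nat Z.opp lozi_iter].
    rewrite SuccNat2Pos.id_succ; reflexivity. }
  assert (hQ : forall n, lozi a b (Q (S n)) = Q n).
  { intros n; rewrite !hQn, Nat.iter_succ; apply lozi_invK; lra. }
  assert (hnear : forall n, (N <= n)%nat -> dist1 (Q n) (fixpt a b) < 1 / (1 + a - b)) by exact hN.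
  assert (hw : forall k, stable_coord a b (Q N) = stable_ev a b ^ k * stable_coord a b (Q (N + k)%nat)).
  { induction k as [|k IH]; [rewrite Nat.add_0_r; cbn; ring|].
    rewrite IH, <- (hQ (N + k)%nat), stable_coord_lozi; trivial.
    - rewrite Nat.add_succ_r; cbn [pow]; ring.
    - specialize (hnear (S (N + k)) ltac:(lia)); unfold dist1, fixpt in hnear; cbn [fst snd] in hnear.
      pose proof (Rabs_pos (snd (Q (S (N + k))) - b / (1 + a - b))).
      assert (h1 : Rabs (fst (Q (S (N + k))) - 1 / (1 + a - b)) < 1 / (1 + a - b)) by lra.
      apply Rabs_def2 in h1; lra. }
  assert (hbound : forall n, (N <= n)%nat -> Rabs (stable_coord a b (Q n)) <= 1 / (1 + a - b)).
  { intros n hn; specialize (hnear n hn); unfold dist1, fixpt in hnear; cbn [fst snd] in hnear.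
    unfold stable_coord; eapply Rle_trans; [apply Rabs_triang|].
    rewrite Rabs_mult, (Rabs_pos_eq (stable_ev a b)) by lra.
    pose proof (Rabs_pos (fst (Q n) - 1 / (1 + a - b))); nra. }
  assert (hw0 : stable_coord a b (Q N) = 0).
  { apply NNPP; intros hne; apply Rabs_pos_lt in hne.
    destruct (pow_lt_1_zero (stable_ev a b) ltac:(rewrite Rabs_pos_eq; lra)
      (Rabs (stable_coord a b (Q N)) / (1 / (1 + a - b)))) as [k hk].
    { apply Rdiv_lt_0_compat; assumption. }
    specialize (hk k (le_n k)); specialize (hbound (N + k)%nat ltac:(lia)).
    apply (Rmult_lt_compat_r _ _ _ hr) in hk.
    unfold Rdiv in hk at 2; rewrite Rmult_assoc, Rinv_l, Rmult_1_r in hk by lra.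
    specialize (hw k); apply (f_equal Rabs) in hw; rewrite Rabs_mult in hw.
    pose proof (Rabs_pos (stable_ev a b ^ k)).
    pose proof (Rmult_le_compat_l _ _ _ H hbound); lra. }
  pose (u := fst (Q N) - 1 / (1 + a - b)).
  assert (eQ : Q N = eigenline a b u).
  { unfold stable_coord in hw0; rewrite (surjective_pairing (Q N)); unfold eigenline, u.
    f_equal; lra. }
  assert (hu : Rabs u < 1 / (1 + a - b)).
  { specialize (hnear N (le_n N)); unfold dist1, fixpt in hnear; cbn [fst snd] in hnear.
    pose proof (Rabs_pos (snd (Q N) - b / (1 + a - b))); unfold u; lra. }
  exists (powerRZ (unstable_ev a b) (Z.of_nat N) * u).
  rewrite <- unstable_curve_iter, unstable_curve_local, <- eQ by assumption.
  rewrite hQn; destruct N as [|N]; [reflexivity|].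
  cbn [Z.of_nat lozi_iter]; rewrite SuccNat2Pos.id_succ.
  clear -hb; induction (S N) as [|m IH]; [reflexivity|].
  rewrite Nat.iter_succ_r, Nat.iter_succ, lozi_invK by lra; exact IH.
- intros [t <-] eps heps.
  destruct (div_pow_small (unstable_ev a b) (Rmin (1 / (1 + a - b)) (eps / 2)) (Rabs t) hl)
    as [N hN]; [apply Rmin_pos; lra|].
  exists N; intros n hn; specialize (hN n t hn (Rle_refl _)).
  pose proof (Rmin_l (1 / (1 + a - b)) (eps / 2)).
  pose proof (Rmin_r (1 / (1 + a - b)) (eps / 2)).
  rewrite unstable_curve_iter, powerRZ_neg', <- pow_powerRZ, Rmult_comm by assumption.
  fold (t / unstable_ev a b ^ n); rewrite unstable_curve_local by (assumption || lra).
  set (u := t / unstable_ev a b ^ n) in *.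
  unfold dist1, eigenline, fixpt; cbn [fst snd].
  replace (1 / (1 + a - b) + u - 1 / (1 + a - b)) with u by ring.
  replace (b / (1 + a - b) - stable_ev a b * u - b / (1 + a - b))
    with (- (stable_ev a b * u)) by ring.
  rewrite Rabs_Ropp, Rabs_mult, (Rabs_pos_eq (stable_ev a b)) by lra.
  pose proof (Rabs_pos u); nra.
Qed.

(** * Directions, corners and folds of the curve *)

Definition ray (P v : plane) (h : R) : plane := (fst P + h * fst v, snd P + h * snd v).

(** The image of a direction (p, q) has second component b p and a first component of modulus at
    least (a - b) |p|, hence at least |p|: the cone is forward invariant. It contains the unstable
    eigenvector since [stable_ev a b <= b]. *)
Definition in_cone (b : R) (v : plane) : Prop := fst v <> 0 /\ Rabs (snd v) <= b * Rabs (fst v).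

(** Let [c] be the sign of the half-plane that the ray enters. There the linear part sends (p, q) to
    (q - a c p, b p), whose first component has the sign of - c p because |q| is at most b |p| and b
    < a. From a point of the axis c p is positive, so every image points left. *)
Lemma lozi_ray (a b : R) (P v : plane) : 0 < b -> 1 + b < a -> in_cone b v ->
  exists v' d, in_cone b v' /\ 0 < d /\
    (forall h, 0 <= h < d -> lozi a b (ray P v h) = ray (lozi a b P) v' h) /\
    (fst P <> 0 -> fst P * (fst v * fst v') < 0) /\ (fst P = 0 -> fst v' < 0).
Proof.
intros hb ha; destruct P as [X Y], v as [p q]; unfold in_cone, lozi, ray; cbn [fst snd].
intros [hp hq].
assert (hd : exists d, 0 < d /\ (X <> 0 -> forall h, 0 <= h < d -> 0 <= X * (X + h * p))).
(* The quotient bounds the time before the ray can reach the axis. From the axis itself the ray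
   never returns, and 1 is an arbitrary positive length. *)
{ exists (Rabs X / Rabs p + (if Req_dec_T X 0 then 1 else 0)).
  assert (hp' := Rabs_pos_lt _ hp).
  destruct (Req_dec_T X 0) as [e|n].
  - split; [|contradiction].
    subst X; rewrite Rabs_R0, Rdiv_0_l; lra.
  - split; [pose proof (Rdiv_lt_0_compat _ _ (Rabs_pos_lt _ n) hp'); lra|].
    intros _ h hh.
    assert (hX : h * Rabs p < Rabs X) by (apply Rlt_div_r; lra).
    pose proof (Rle_abs (- (X * (h * p)))) as h1.
    rewrite Rabs_Ropp, !Rabs_mult, (Rabs_pos_eq h) in h1 by lra.
    pose proof (Rabs_pos X) as h2; pose proof (pow2_abs X) as h3; nra. }
destruct hd as [d [hd0 hd]].
assert (hside : X > 0 \/ (X = 0 /\ 0 < p) \/ X < 0 \/ (X = 0 /\ p < 0)) by lra.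
assert (hcase : exists c, (c = 1 \/ c = -1) /\ (forall h, 0 <= h < d -> 0 <= c * (X + h * p)) /\
  0 <= c * X /\ (X = 0 -> 0 < c * p)).
{ destruct hside as [h|[h|[h|h]]].
  - exists 1; split; [lra|split; [|lra]]; intros s hs; specialize (hd ltac:(lra) s hs); nra.
  - exists 1; split; [lra|split; [|lra]]; intros s hs; nra.
  - exists (-1); split; [lra|split; [|lra]]; intros s hs; specialize (hd ltac:(lra) s hs); nra.
  - exists (-1); split; [lra|split; [|lra]]; intros s hs; nra. }
destruct hcase as [c [hc [h1 [h2 h3]]]].
assert (hq' : - (b * Rabs p) <= q <= b * Rabs p) by (apply Rabs_le_between; exact hq).
assert (habs : forall y, 0 <= c * y -> Rabs y = c * y).
{ intros y hy; destruct hc as [-> | ->]; [rewrite Rabs_pos_eq|rewrite Rabs_left1]; lra. }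
exists (q - a * c * p, b * p), d; cbn [fst snd].
assert (hgrow : Rabs p <= Rabs (q - a * c * p) /\ c * p * (q - a * c * p) < 0).
{ revert hq'; unfold Rabs; destruct (Rcase_abs p), (Rcase_abs (q - a * c * p)), hc as [-> | ->];
    intros; split; nra. }
destruct hgrow as [hg1 hg2].
split; [split|split; [exact hd0|split; [|split]]].
- intros e; rewrite e in hg2; lra.
- rewrite Rabs_mult, (Rabs_pos_eq b) by lra; apply Rmult_le_compat_l; lra.
- intros h hh; rewrite (habs _ (h1 h hh)), (habs _ h2); f_equal; ring.
- intros hX; destruct hc as [-> | ->]; nra.
- intros hX; specialize (h3 hX); nra.
Qed.

Lemma factor_sign (x y : R) : 0 < x * y -> (x < 0 -> y < 0) /\ (0 < x -> 0 < y).
Proof. intros h; split; intros; nra. Qed.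

(* Local form of the unstable curve: a broken line with at most one corner, the
   vectors [v] and [w] pointing away from the corner; the curve turns back in the
   horizontal direction exactly at the strict forward images of the y-axis. *)
Lemma unstable_curve_germ (a b t : R) : 0 < b -> 1 + b < a ->
  exists v w d, in_cone b v /\ in_cone b w /\ 0 < d /\
    (forall h, 0 <= h < d -> unstable_curve a b (t + h) = ray (unstable_curve a b t) v h /\
      unstable_curve a b (t - h) = ray (unstable_curve a b t) w h) /\
    ((forall j, (1 <= j)%nat -> fst (unstable_curve a b (t / unstable_ev a b ^ j)) <> 0) ->
      fst v * fst w < 0) /\
    (forall j, (1 <= j)%nat -> fst (unstable_curve a b (t / unstable_ev a b ^ j)) = 0 ->
      0 < fst v * fst w).
Proof.
intros hb ha; pose proof (unstable_ev_lt a b hb ha) as hl.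
pose proof (stable_ev_bounds a b hb ha) as hs.
destruct (stage_exists a b (Rabs t) hb ha) as [n hn]; specialize (hn t (Rle_refl _)).
revert t hn; induction n as [|n IH]; intros t ht.
- cbn [pow] in ht; rewrite Rdiv_1_r in ht.
  exists (1, - stable_ev a b), (-1, stable_ev a b), (1 / (1 + a - b) - Rabs t).
  unfold in_cone, ray; cbn [fst snd].
  rewrite Rabs_Ropp, (Rabs_pos_eq (stable_ev a b)), (Rabs_left (-1)), (Rabs_pos_eq 1) by lra.
  split; [lra|split; [lra|split; [lra|split; [|split; [lra|]]]]].
  + intros h hh; rewrite !unstable_curve_local; trivial.
    * unfold eigenline; cbn [fst snd]; split; f_equal; ring.
    * replace (t - h) with (t + - h) by ring; eapply Rle_lt_trans; [apply Rabs_triang|].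
      rewrite Rabs_Ropp, (Rabs_pos_eq h); lra.
    * eapply Rle_lt_trans; [apply Rabs_triang|].
      rewrite (Rabs_pos_eq h); lra.
  + intros j _ e; exfalso.
    destruct (stage_add a b t 0 j hb ha) as [h1 _].
    { cbn [pow]; rewrite Rdiv_1_r; exact ht. }
    rewrite Nat.add_0_l in h1; rewrite unstable_curve_local in e by assumption.
    unfold eigenline in e; cbn [fst] in e; apply Rabs_def2 in h1; lra.
- pose (u := t / unstable_ev a b).
  assert (et : t = unstable_ev a b * u) by (unfold u; field; lra).
  assert (hp : unstable_ev a b ^ n <> 0) by (apply pow_nonzero; lra).
  destruct (IH u) as [v [w [d [hv [hw [hd [hg [h1 h2]]]]]]]].
  { replace (u / unstable_ev a b ^ n) with (t / unstable_ev a b ^ S n); [exact ht|].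
    unfold u; cbn [pow]; field; split; [lra|exact hp]. }
  set (P := unstable_curve a b u) in *.
  destruct (lozi_ray a b P v hb ha hv) as [v' [dv [hv' [hdv [hrv [hv1 hv2]]]]]].
  destruct (lozi_ray a b P w hb ha hw) as [w' [dw [hw' [hdw [hrw [hw1 hw2]]]]]].
  pose (m := - unstable_ev a b); assert (hm : 0 < m) by (unfold m; lra).
  pose (D := Rmin d (Rmin dv dw)).
  assert (hD : 0 < D /\ D <= d /\ D <= dv /\ D <= dw).
  { unfold D; pose proof (Rmin_l d (Rmin dv dw)); pose proof (Rmin_r d (Rmin dv dw)).
    pose proof (Rmin_l dv dw); pose proof (Rmin_r dv dw).
    split; [repeat apply Rmin_pos; assumption|lra]. }
  assert (hscale : forall z, in_cone b z -> in_cone b (fst z / m, snd z / m)).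
  { intros z [hz1 hz2]; unfold in_cone; cbn [fst snd]; split.
    - unfold Rdiv; apply Rmult_integral_contrapositive_currified; [exact hz1|].
      apply Rinv_neq_0_compat; lra.
    - unfold Rdiv; rewrite !Rabs_mult, <- Rmult_assoc; apply Rmult_le_compat_r; [apply Rabs_pos|exact hz2]. }
  (* The factor [unstable_ev] is negative, so the two directions change places; division by its
     modulus restores the parametrization. *)
  exists (fst w' / m, snd w' / m), (fst v' / m, snd v' / m), (m * D); cbn [fst snd].
  split; [apply hscale, hw'|split; [apply hscale, hv'|split; [apply Rmult_lt_0_compat; lra|split]]].
  { intros h hh; rewrite et at 1 2 3 4.
    assert (hhm : 0 <= h / m < D).
    { split; [apply Rdiv_le_0_compat; lra|].
      apply Rlt_div_l; lra. }
    assert (eplus : unstable_ev a b * u + h = unstable_ev a b * (u - h / m)).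
    { unfold m; field; lra. }
    assert (eminus : unstable_ev a b * u - h = unstable_ev a b * (u + h / m)).
    { unfold m; field; lra. }
    rewrite eplus, eminus, !unstable_curve_lozi by assumption.
    destruct (hg (h / m) ltac:(lra)) as [g1 g2]; rewrite g1, g2; fold P.
    rewrite hrv, hrw by lra; unfold ray; cbn [fst snd]; split; f_equal; field; lra. }
  assert (hprod : fst w' / m * (fst v' / m) = (fst v' * fst w') * (/ m) ^ 2) by (field; lra).
  assert (him : 0 < (/ m) ^ 2) by (apply pow_lt, Rinv_0_lt_compat, hm).
  assert (hshift : forall j, t / unstable_ev a b ^ S j = u / unstable_ev a b ^ j).
  { intros j; unfold u; cbn [pow]; field; split; [|apply pow_nonzero]; lra. }
  (* Off the axis both horizontal directions are multiplied by the same sign, so the type of the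
     corner persists. *)
  assert (hkeep : fst P <> 0 -> 0 < (fst v * fst w) * (fst v' * fst w')).
  { intros hP; specialize (hv1 hP); specialize (hw1 hP).
    assert (hmul : 0 < (fst P * (fst v * fst v')) * (fst P * (fst w * fst w'))).
    { clear - hv1 hw1; nra. }
    replace ((fst P * (fst v * fst v')) * (fst P * (fst w * fst w')))
      with (fst P ^ 2 * ((fst v * fst w) * (fst v' * fst w'))) in hmul by ring.
    apply Rmult_lt_reg_l with (fst P ^ 2); [apply pow2_gt_0, hP|].
    rewrite Rmult_0_r; exact hmul. }
  rewrite hprod; split.
  + intros hz.
    assert (hP : fst P <> 0).
    { specialize (hz 1%nat (le_n 1)); rewrite hshift in hz; cbn [pow] in hz.
      rewrite Rdiv_1_r in hz; exact hz. }
    specialize (hkeep hP).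
    assert (fst v * fst w < 0).
    { apply h1; intros j hj; rewrite <- hshift; apply hz; lia. }
    pose proof (proj1 (factor_sign _ _ hkeep) H); clear - him H0; nra.
  + intros [|j] hj hz; [lia|]; rewrite hshift in hz.
    (* With the immediate preimage on the axis both new directions point left; otherwise the fold is
       older and is inherited. *)
    destruct (Req_dec (fst P) 0) as [e0|n0].
    * specialize (hv2 e0); specialize (hw2 e0).
      apply Rmult_lt_0_compat; [clear - hv2 hw2; nra|exact him].
    * specialize (hkeep n0).
      assert (0 < fst v * fst w).
      { apply (h2 j); [|exact hz].
        destruct j as [|j]; [|lia].
        exfalso; apply n0; cbn [pow] in hz; rewrite Rdiv_1_r in hz; exact hz. }
      apply Rmult_lt_0_compat; [exact (proj2 (factor_sign _ _ hkeep) H)|exact him].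
Qed.

(** The witness [c] is the horizontal component of the right-hand direction; an opposite left-hand
    component makes the zero a crossing, one of equal sign an extremum. *)
Lemma unstable_curve_folded (a b : R) : 0 < b -> 1 + b < a ->
  folded (unstable_ev a b) (fun t => fst (unstable_curve a b t)).
Proof.
intros hb ha; split.
- apply unstable_ev_lt; assumption.
- intros t; apply eps_continuity_pt; intros eps heps.
  destruct (unstable_curve_cont a b t hb ha eps heps) as [d [hd h]].
  exists d; split; [exact hd|]; intros s hs; specialize (h s hs); unfold dist1 in h.
  pose proof (Rabs_pos (snd (unstable_curve a b s) - snd (unstable_curve a b t))); lra.
- exists (1 / (1 + a - b)); split; [apply Rdiv_lt_0_compat; lra|].
  intros t ht; rewrite unstable_curve_local by assumption.
  unfold eigenline; cbn [fst]; apply Rabs_def2 in ht; lra.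
- intros t ht hz.
  destruct (unstable_curve_germ a b t hb ha) as [v [w [d [_ [_ [hd [hg [h1 _]]]]]]]].
  specialize (h1 hz); exists (fst v), d; split; [exact hd|]; intros s hs.
  destruct (Rle_or_lt t s) as [hle|hlt].
  + rewrite Rabs_pos_eq in hs by lra.
    destruct (hg (s - t) ltac:(lra)) as [g _].
    replace (t + (s - t)) with s in g by ring; rewrite g; unfold ray; cbn [fst snd].
    rewrite ht; replace (fst v * ((s - t) * (0 + (s - t) * fst v)))
      with (((s - t) * fst v) ^ 2) by ring.
    apply pow2_gt_0, Rmult_integral_contrapositive_currified; [lra|intros e; rewrite e in h1; lra].
  + rewrite Rabs_left in hs by lra.
    destruct (hg (t - s) ltac:(lra)) as [_ g].
    replace (t - (t - s)) with s in g by ring; rewrite g; unfold ray; cbn [fst snd].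
    rewrite ht; replace (fst v * ((s - t) * (0 + (t - s) * fst w)))
      with (- (fst v * fst w) * (t - s) ^ 2) by ring.
    apply Rmult_lt_0_compat; [lra|apply pow2_gt_0; lra].
- intros t j ht hj hz.
  destruct (unstable_curve_germ a b t hb ha) as [v [w [d [_ [_ [hd [hg [_ h2]]]]]]]].
  specialize (h2 j hj hz); exists (fst v), d; split; [exact hd|]; intros s hs.
  destruct (Rle_or_lt t s) as [hle|hlt].
  + rewrite Rabs_pos_eq in hs by lra.
    destruct (hg (s - t) ltac:(lra)) as [g _].
    replace (t + (s - t)) with s in g by ring; rewrite g; unfold ray; cbn [fst snd].
    rewrite ht; replace (fst v * (0 + (s - t) * fst v)) with ((s - t) * fst v ^ 2) by ring.
    apply Rmult_lt_0_compat; [lra|apply pow2_gt_0; intros e; rewrite e in h2; lra].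
  + rewrite Rabs_left in hs by lra.
    destruct (hg (t - s) ltac:(lra)) as [_ g].
    replace (t - (t - s)) with s in g by ring; rewrite g; unfold ray; cbn [fst snd].
    rewrite ht; replace (fst v * (0 + (t - s) * fst w)) with ((t - s) * (fst v * fst w)) by ring.
    apply Rmult_lt_0_compat; lra.
Qed.

(** * Absence of limits at the ends of the curve *)

(** For q = (0, Y) the equation gives a |1 + Y| = 1 and (1 - b)(1 + Y) = 1, so |1 - b| = a, against
    1 + b < a. *)
Lemma period2_off_axis (a b : R) (q : plane) : 0 < b -> 1 + b < a ->
  lozi a b (lozi a b q) = q -> fst q <> 0.
Proof.
intros hb ha; destruct q as [X Y]; unfold lozi; cbn [fst snd]; intros e eX.
injection e as e1 e2; subst X; rewrite Rabs_R0 in e1, e2.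
replace (1 + Y - a * 0) with (1 + Y) in e1, e2 by ring.
assert (h : a * Rabs (1 + Y) = 1) by lra.
assert (h2 : (1 - b) * (1 + Y) = 1) by lra.
apply (f_equal Rabs) in h2; rewrite Rabs_mult, Rabs_R1 in h2.
assert (Rabs (1 - b) < a) by (apply Rabs_def1; lra).
assert (0 < Rabs (1 + Y)) by (pose proof (Rabs_pos (1 + Y)); nra).
nra.
Qed.

Lemma lozi_cone_expansion (a b : R) (P Q : plane) : 0 < b -> 1 + b < a ->
  0 < fst P * fst Q -> Rabs (snd P - snd Q) <= b * Rabs (fst P - fst Q) ->
  Rabs (fst P - fst Q) <= Rabs (fst (lozi a b P) - fst (lozi a b Q)) /\
  Rabs (snd (lozi a b P) - snd (lozi a b Q))
    <= b * Rabs (fst (lozi a b P) - fst (lozi a b Q)).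
Proof.
intros hb ha hPQ hc; destruct P as [x y], Q as [x' y']; unfold lozi; cbn [fst snd] in *.
assert (h : Rabs (x - x') <= Rabs (1 + y - a * Rabs x - (1 + y' - a * Rabs x'))).
{ assert (core : forall c, Rabs c = 1 ->
    Rabs (x - x') <= Rabs (y - y' - c * (a * (x - x')))).
  { intros c hc1; pose proof (Rabs_triang (y - y') (- (y - y' - c * (a * (x - x'))))) as tri.
    replace (y - y' + - (y - y' - c * (a * (x - x')))) with (c * (a * (x - x'))) in tri by ring.
    rewrite Rabs_Ropp, !Rabs_mult, hc1, (Rabs_pos_eq a) in tri by lra.
    pose proof (Rmult_le_pos (a - b - 1) (Rabs (x - x')) ltac:(lra) (Rabs_pos _)); lra. }
  assert (hs : (0 < x /\ 0 < x') \/ (x < 0 /\ x' < 0)).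
  { destruct (Rtotal_order x 0) as [hx|[->|hx]]; [right|lra|left]; split; nra. }
  destruct hs as [[h1 h2]|[h1 h2]].
  - rewrite (Rabs_pos_eq x), (Rabs_pos_eq x') by lra.
    eapply Rle_trans; [apply (core 1), Rabs_R1|right; f_equal; ring].
  - rewrite (Rabs_left x), (Rabs_left x') by lra.
    eapply Rle_trans; [apply (core (-1)); rewrite Rabs_left; lra|right; f_equal; ring]. }
split; [exact h|].
replace (b * x - b * x') with (b * (x - x')) by ring.
rewrite Rabs_mult, (Rabs_pos_eq b) by lra; apply Rmult_le_compat_l; lra.
Qed.

Lemma limit_right_unique (f : R -> plane) (p q : plane) :
  limit_right f p -> limit_right f q -> p = q.
Proof.
intros hp hq; apply NNPP; intros hne; apply dist1_pos in hne.
destruct (hp (dist1 p q / 2) ltac:(lra)) as [M1 h1].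
destruct (hq (dist1 p q / 2) ltac:(lra)) as [M2 h2].
pose (s := Rmax M1 M2 + 1).
specialize (h1 s ltac:(unfold s; pose proof (Rmax_l M1 M2); lra)).
specialize (h2 s ltac:(unfold s; pose proof (Rmax_r M1 M2); lra)).
pose proof (dist1_triangle p (f s) q) as h; rewrite (dist1_sym p (f s)) in h; lra.
Qed.

(** As [unstable_ev] is negative, [lozi] exchanges the ends of the curve; [f] and [g] stand for the
    curve and its mirror, in either order. *)
Lemma limit_right_lozi (a b : R) (f g : R -> plane) (q : plane) : 0 < b -> 1 + b < a ->
  (forall s, g s = lozi a b (f (s / - unstable_ev a b))) ->
  limit_right f q -> limit_right g (lozi a b q).
Proof.
intros hb ha hfg hq eps heps; pose proof (unstable_ev_lt a b hb ha) as hl.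
destruct (hq (eps / (1 + a + b))) as [M hM]; [apply Rdiv_lt_0_compat; lra|].
exists (M * - unstable_ev a b); intros s hs; rewrite hfg.
eapply Rle_lt_trans; [apply lozi_lipschitz; lra|].
rewrite Rmult_comm; apply Rlt_div_r; [lra|]; apply hM.
apply Rlt_div_r; lra.
Qed.

(** A limit at one end gives its image as limit at the other, and so satisfies the period-two
    equation. Both limits are off the axis, so the first coordinate has constant sign far out on
    each end. Two points far out on one straight piece then keep their horizontal distance under
    iteration, although their even iterates tend to the same limit. *)
Lemma unstable_curve_no_limit_right (a b : R) (q : plane) : 0 < b -> 1 + b < a ->
  ~ limit_right (unstable_curve a b) q.
Proof.
intros hb ha hq; pose proof (unstable_ev_lt a b hb ha) as hl.
set (lam := unstable_ev a b) in *.
assert (hm : limit_right (mirror (unstable_curve a b)) (lozi a b q)).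
{ apply limit_right_lozi with (unstable_curve a b); trivial.
  intros s; unfold mirror; rewrite <- unstable_curve_lozi by assumption; fold lam.
  f_equal; field; lra. }
assert (hq2 : lozi a b (lozi a b q) = q).
{ apply (limit_right_unique (unstable_curve a b)); [|exact hq].
  apply limit_right_lozi with (mirror (unstable_curve a b)); trivial.
  intros s; unfold mirror; rewrite <- unstable_curve_lozi by assumption; fold lam.
  f_equal; field; lra. }
assert (sign : forall f r, limit_right f r -> fst r <> 0 ->
  exists M, forall s, M < s -> 0 < fst r * fst (f s)).
{ intros f r hf hr; destruct (hf (Rabs (fst r)) (Rabs_pos_lt _ hr)) as [M hM].
  exists M; intros s hs; specialize (hM s hs); unfold dist1 in hM.
  pose proof (Rabs_pos (snd (f s) - snd r)).
  assert (h : Rabs (fst (f s) - fst r) < Rabs (fst r)) by lra.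
  apply Rabs_def2 in h; revert h; unfold Rabs; destruct (Rcase_abs (fst r)); intros; nra. }
destruct (sign _ _ hq (period2_off_axis a b q hb ha hq2)) as [M1 h1].
destruct (sign _ _ hm) as [M2 h2].
{ apply (period2_off_axis a b); [exact hb|exact ha|rewrite hq2; reflexivity]. }
pose (t := Rmax 1 (Rmax M1 M2) + 1).
assert (ht : 1 < t /\ M1 < t /\ M2 < t).
{ pose proof (Rmax_l 1 (Rmax M1 M2)); pose proof (Rmax_r 1 (Rmax M1 M2)).
  pose proof (Rmax_l M1 M2); pose proof (Rmax_r M1 M2); unfold t; lra. }
destruct (unstable_curve_germ a b t hb ha) as [v [w [d [[hv1 hv2] [_ [hd [hg _]]]]]]].
pose (t' := t + d / 2).
destruct (hg (d / 2) ltac:(lra)) as [et' _]; fold t' in et'.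
assert (same : forall (m : nat) s s', t <= s -> t <= s' ->
  0 < fst (unstable_curve a b (lam ^ m * s)) * fst (unstable_curve a b (lam ^ m * s'))).
(* Iteration alternates between the ends and never moves a parameter [s >= 1] closer to 0, so the
   sign controls [h1] and [h2] remain available. *)
{ assert (hbig : forall m : nat, (1 <= lam ^ m /\ forall s, 1 <= s -> s <= lam ^ m * s) \/
    (lam ^ m <= -1 /\ forall s, 1 <= s -> s <= - (lam ^ m * s))).
  { induction m as [|m [[IH _]|[IH _]]]; cbn [pow].
    - left; split; [lra|intros; lra].
    - right; split; [nra|intros s hs; assert (lam * lam ^ m <= -1) by nra; nra].
    - left; split; [nra|intros s hs; assert (1 <= lam * lam ^ m) by nra; nra]. }
  intros m s s' hs hs'; destruct (hbig m) as [[_ h]|[_ h]].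
  - pose proof (h1 (lam ^ m * s) ltac:(specialize (h s); lra)).
    pose proof (h1 (lam ^ m * s') ltac:(specialize (h s'); lra)).
    nra.
  - pose proof (h2 (- (lam ^ m * s)) ltac:(specialize (h s); lra)) as e1.
    pose proof (h2 (- (lam ^ m * s')) ltac:(specialize (h s'); lra)) as e2.
    unfold mirror in e1, e2; rewrite Ropp_involutive in e1, e2; nra. }
pose (A := fun m : nat => unstable_curve a b (lam ^ m * t)).
pose (A' := fun m : nat => unstable_curve a b (lam ^ m * t')).
assert (hA : forall m, A (S m) = lozi a b (A m) /\ A' (S m) = lozi a b (A' m)).
{ intros m; unfold A, A'; rewrite <- !unstable_curve_lozi by assumption; fold lam.
  cbn [pow]; rewrite !Rmult_assoc; split; reflexivity. }
assert (hexp : forall m, Rabs (d / 2 * fst v) <= Rabs (fst (A' m) - fst (A m)) /\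
  Rabs (snd (A' m) - snd (A m)) <= b * Rabs (fst (A' m) - fst (A m))).
{ induction m as [|m [IH1 IH2]].
  - unfold A, A'; cbn [pow]; rewrite !Rmult_1_l, et'; unfold ray; cbn [fst snd].
    set (P := unstable_curve a b t).
    replace (fst P + d / 2 * fst v - fst P) with (d / 2 * fst v) by ring.
    replace (snd P + d / 2 * snd v - snd P) with (d / 2 * snd v) by ring.
    split; [apply Rle_refl|]; rewrite !Rabs_mult, (Rabs_pos_eq (d / 2)) by lra; nra.
  - destruct (hA m) as [-> ->].
    destruct (lozi_cone_expansion a b (A' m) (A m) hb ha) as [g1 g2].
    + apply same; unfold t'; lra.
    + exact IH2.
    + split; [lra|exact g2]. }
assert (hpos : 0 < Rabs (d / 2 * fst v)).
{ apply Rabs_pos_lt, Rmult_integral_contrapositive_currified; lra. }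
destruct (hq (Rabs (d / 2 * fst v) / 2) ltac:(lra)) as [M hM].
destruct (Pow_x_infinity lam ltac:(rewrite Rabs_left; lra) (Rabs M + 1)) as [N hN].
(* An even power brings both points back to the right end, where the limit is [q]. *)
specialize (hN (2 * N)%nat ltac:(lia)).
assert (hsq : 0 <= lam ^ (2 * N)) by (rewrite pow_mult; apply pow_le, pow2_ge_0).
rewrite Rabs_pos_eq in hN by exact hsq.
pose proof (Rle_abs M); pose proof (Rabs_pos M).
assert (htt : t < t') by (unfold t'; lra).
pose proof (hM (lam ^ (2 * N) * t) ltac:(nra)) as d1.
pose proof (hM (lam ^ (2 * N) * t') ltac:(nra)) as d2.
destruct (hexp (2 * N)%nat) as [g _]; unfold A, A' in g.
set (P := unstable_curve a b (lam ^ (2 * N) * t)) in *.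
set (Q := unstable_curve a b (lam ^ (2 * N) * t')) in *.
pose proof (dist1_triangle Q q P) as tri; rewrite (dist1_sym q P) in tri.
assert (Rabs (fst Q - fst P) <= dist1 Q P).
{ unfold dist1; pose proof (Rabs_pos (snd Q - snd P)); lra. }
lra.
Qed.

Lemma unstable_curve_no_limit_left (a b : R) (q : plane) : 0 < b -> 1 + b < a ->
  ~ limit_right (mirror (unstable_curve a b)) q.
Proof.
intros hb ha hq; pose proof (unstable_ev_lt a b hb ha) as hl.
apply (unstable_curve_no_limit_right a b (lozi a b q) hb ha).
apply limit_right_lozi with (mirror (unstable_curve a b)); trivial.
intros s; unfold mirror; rewrite <- unstable_curve_lozi by assumption.
f_equal; field; lra.
Qed.

(** * Transfer to an arbitrary parametrization *)

Lemma unstable_param_lift (a b : R) (phi : R -> plane) : 0 < b -> 1 + b < a ->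
  unstable_param a b phi ->
  exists h : R -> R, (forall t, unstable_curve a b (h t) = phi t) /\
    (forall t, continuity_pt h t) /\ (forall s t, s < t -> h s < h t) /\
    (forall s, exists t, h t = s).
Proof.
intros hb ha H.
assert (hr : 0 < 1 / (1 + a - b)) by (apply Rdiv_lt_0_compat; lra).
assert (hex : forall t, exists s, unstable_curve a b s = phi t).
{ intros t; apply unstable_range; [exact hb|exact ha|].
  apply (param_range _ _ _ H); exists t; reflexivity. }
pose (h := fun t => proj1_sig (constructive_indefinite_description _ (hex t))).
assert (hh : forall t, unstable_curve a b (h t) = phi t).
{ intros t; exact (proj2_sig (constructive_indefinite_description _ (hex t))). }
assert (L : curve_lift phi (unstable_curve a b) h).
{ split.
  - exact hh.
  - intros t; apply continuous_curve_cont, (param_continuous _ _ _ H).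
  - apply (param_injective _ _ _ H).
  - intros t; apply unstable_curve_cont; assumption.
  - intros s t; apply unstable_curve_inj; assumption.
  - intros q; apply unstable_curve_no_limit_right; assumption.
  - intros q; apply unstable_curve_no_limit_left; assumption. }
pose proof (lift_continuous _ _ _ L) as hc.
assert (hinj : forall s t, h s = h t -> s = t).
{ intros s t e; apply (param_injective _ _ _ H); rewrite <- !hh, e; reflexivity. }
assert (h0 : h 0 = 0).
{ apply (unstable_curve_inj a b); trivial.
  rewrite hh, (param_origin _ _ _ H), unstable_curve_local; [|exact hb|exact ha|].
  - unfold fixpt, eigenline; f_equal; ring.
  - rewrite Rabs_R0; exact hr. }
assert (hd : exists d, 0 < d /\ h 0 < h d).
{ destruct (param_right _ _ _ H) as [e [he hright]].
  destruct (continuity_pt_eps h 0 (hc 0) _ hr) as [d [hd hd']].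
  (* Small enough for [param_right] to apply and for [h u] to stay in the linear zone, where lying
     to the right of the fixed point means a positive parameter. *)
  pose (u := Rmin e d / 2).
  assert (hu : 0 < u /\ u < e /\ u < d).
  { pose proof (Rmin_l e d); pose proof (Rmin_r e d).
    assert (0 < Rmin e d) by (apply Rmin_pos; assumption); unfold u; lra. }
  exists u; split; [lra|].
  specialize (hd' u); rewrite Rminus_0_r, (Rabs_pos_eq u), h0, Rminus_0_r in hd' by lra.
  specialize (hright u ltac:(lra)).
  rewrite <- hh, unstable_curve_local in hright; [|exact hb|exact ha|apply hd'; lra].
  unfold fixpt, eigenline in hright; cbn [fst] in hright; lra. }
destruct hd as [d [hd hd']].
exists h; split; [exact hh|split; [exact hc|split]].
- exact (continuous_injective_increasing h d hc hinj hd hd').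
- intros s; assert (hu : unstable a b (unstable_curve a b s)).
  { apply unstable_range; [exact hb|exact ha|exists s; reflexivity]. }
  apply (param_range _ _ _ H) in hu; destruct hu as [t et]; exists t.
  apply (unstable_curve_inj a b); trivial; rewrite hh; exact et.
Qed.

Lemma basic_unstable_curve (a b t : R) : 0 < b -> 1 + b < a ->
  basic a b (unstable_curve a b t) <->
  exists j : nat, fst (unstable_curve a b (t / unstable_ev a b ^ j)) = 0.
Proof.
intros hb ha; pose proof (unstable_curve_folded a b hb ha) as F.
pose proof (unstable_ev_lt a b hb ha) as hl.
assert (hp : forall n : nat, unstable_ev a b ^ n <> 0) by (intros n; apply pow_nonzero; lra).
split.
- intros [G [j [[hG1 [hG2 _]] e]]].
  apply unstable_range in hG1; [|exact hb|exact ha]; destruct hG1 as [g <-].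
  rewrite unstable_curve_iter, <- pow_powerRZ in e by assumption.
  apply unstable_curve_inj in e; [|exact hb|exact ha]; subst t.
  exists j; replace (unstable_ev a b ^ j * g / unstable_ev a b ^ j) with g; [exact hG2|].
  field; apply hp.
- intros [j0 hj0].
  destruct (fold_pos _ _ F) as [r [hr hpos]].
  destruct (div_pow_small (unstable_ev a b) r (Rabs t) hl hr) as [N hN].
  (* The gluing point is the earliest visit to the axis, hence the largest [j]; it exists because
     remote preimages lie near the fixed point, off the axis. *)
  assert (hj : exists j : nat, fst (unstable_curve a b (t / unstable_ev a b ^ j)) = 0 /\
    forall k, (j < k)%nat -> fst (unstable_curve a b (t / unstable_ev a b ^ k)) <> 0).
  { assert (hN' : forall k, (N <= k)%nat -> fst (unstable_curve a b (t / unstable_ev a b ^ k)) <> 0).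
    { intros k hk e; specialize (hpos _ (hN k t hk (Rle_refl _))); cbn in hpos; lra. }
    clear hN; revert hN'; induction N as [|N IH]; intros hN'.
    - exfalso; apply (hN' j0); [lia|exact hj0].
    - destruct (Req_dec (fst (unstable_curve a b (t / unstable_ev a b ^ N))) 0) as [e|n].
      + exists N; split; [exact e|intros k hk; apply hN'; lia].
      + apply IH; intros k hk; destruct (Nat.eq_dec k N) as [->|hne]; [exact n|].
        apply hN'; lia. }
  destruct hj as [j [hj hlast]].
  exists (unstable_curve a b (t / unstable_ev a b ^ j)), j; split; [split; [|split]|].
  + apply unstable_range; [exact hb|exact ha|eexists; reflexivity].
  + exact hj.
  + intros k hk; rewrite unstable_curve_iter by assumption.
    replace (powerRZ (unstable_ev a b) (- k) * (t / unstable_ev a b ^ j))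
      with (t / unstable_ev a b ^ (j + Z.to_nat k)); [apply hlast; lia|].
    rewrite <- (Z2Nat.id k) at 2 by lia.
    rewrite powerRZ_neg', <- pow_powerRZ, pow_add; field; split; apply hp.
  + rewrite unstable_curve_iter, <- pow_powerRZ by assumption; f_equal; field; apply hp.
Qed.

Lemma arc_lift (f g : R -> plane) (h : R -> R) (u v : R) (T : plane) :
  (forall t, g (h t) = f t) -> (forall s t, g s = g t -> s = t) ->
  (forall s t, s < t -> h s < h t) -> (forall s, exists t, h t = s) -> u < v ->
  arc f (g u) (g v) T <-> exists s, u <= s <= v /\ g s = T.
Proof.
intros hgf hinj hinc hsurj huv.
assert (hle : forall s t, s <= t -> h s <= h t).
{ intros s t [hst| ->]; [apply Rlt_le, hinc, hst|apply Rle_refl]. }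
assert (hle' : forall s t, h s <= h t -> s <= t).
{ intros s t hst; apply Rnot_lt_le; intros hlt; apply hinc in hlt; lra. }
split.
- intros [r [s [t [er [es [et hs]]]]]].
  rewrite <- hgf in er, et; apply hinj in er, et; subst u v.
  assert (hrt : r <= t) by (apply hle'; lra).
  rewrite Rmin_left, Rmax_right in hs by exact hrt.
  exists (h s); split; [split; apply hle; lra|rewrite hgf; exact es].
- intros [s [hs <-]].
  destruct (hsurj u) as [r <-], (hsurj v) as [t <-], (hsurj s) as [s' <-].
  exists r, s', t; rewrite !hgf.
  assert (hrt : r <= t) by (apply hle'; lra).
  rewrite Rmin_left, Rmax_right by exact hrt.
  repeat split; apply hle'; lra.
Qed.

Lemma near_on_lift (f g : R -> plane) (h : R -> R) (u : R) (A : plane -> Prop) :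
  (forall t, g (h t) = f t) -> (forall s t, g s = g t -> s = t) ->
  (forall t, continuity_pt h t) ->
  (forall s t, s < t -> h s < h t) -> (forall s, exists t, h t = s) ->
  near_on f (g u) A <->
  exists d, 0 < d /\ forall s, 0 < Rabs (s - u) < d -> A (g s).
Proof.
intros hgf hinj hc hinc hsurj; destruct (hsurj u) as [t0 et0]; subst u.
split.
- intros hn; destruct (hn t0) as [d hd]; [rewrite hgf; reflexivity|].
  pose proof (cond_pos d) as hdp.
  pose proof (hinc (t0 - d / 2) t0 ltac:(lra)) as i1.
  pose proof (hinc t0 (t0 + d / 2) ltac:(lra)) as i2.
  (* By monotonicity, a parameter of [g] within this distance of [h t0] comes from within [d] of
     [t0]. *)
  exists (Rmin (h t0 - h (t0 - d / 2)) (h (t0 + d / 2) - h t0)).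
  split; [apply Rmin_pos; lra|]; intros s hs.
  pose proof (Rmin_l (h t0 - h (t0 - d / 2)) (h (t0 + d / 2) - h t0)).
  pose proof (Rmin_r (h t0 - h (t0 - d / 2)) (h (t0 + d / 2) - h t0)).
  destruct (hsurj s) as [r er]; subst s; rewrite hgf; apply hd.
  + destruct hs as [_ hs]; apply Rabs_def2 in hs.
    change (Rabs (r - t0) < d); apply Rabs_def1.
    * apply Rnot_le_lt; intros hle.
      pose proof (hinc (t0 + d / 2) r ltac:(lra)); lra.
    * apply Rnot_le_lt; intros hle.
      pose proof (hinc r (t0 - d / 2) ltac:(lra)); lra.
  + rewrite <- !hgf; intros e; apply hinj in e; rewrite e, Rminus_diag, Rabs_R0 in hs; lra.
- intros [d [hd hA]] t et.
  rewrite <- hgf in et; apply hinj in et.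
  destruct (continuity_pt_eps h t (hc t) d hd) as [d' [hd' h']].
  exists (mkposreal d' hd'); intros s hs hne; rewrite <- hgf; apply hA.
  rewrite <- et; split; [|apply h'; exact hs].
  apply Rabs_pos_lt; intros e0; apply hne.
  rewrite <- !hgf; f_equal; lra.
Qed.

Theorem theorem10 (a b : R) (hS : in_S a b)
    (phi : R -> plane) (hphi : unstable_param a b phi)
    (E : Z -> plane) (hE : basic_numbering a b phi E)
    (p : Z -> symbol) :
  essential_admissible a b phi p <-> sign_path a b phi E p.
Proof.
destruct (in_S_bounds a b hS) as [hb ha].
destruct (unstable_param_lift a b phi hb ha hphi) as [h [hgf [hc [hinc hsurj]]]].
pose proof (unstable_curve_folded a b hb ha) as F.
pose proof (unstable_ev_lt a b hb ha) as hl.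
set (lam := unstable_ev a b) in *; set (g := unstable_curve a b) in *.
assert (hinj : forall s t, g s = g t -> s = t).
{ intros s t; apply unstable_curve_inj; assumption. }
assert (hEex : forall i, exists t, g t = E i).
{ intros i; assert (hbas : basic a b (E i)).
  { apply (numbering_basic _ _ _ _ hE); exists i; reflexivity. }
  destruct hbas as [G [j [[hG _] ->]]].
  apply unstable_range in hG; [|exact hb|exact ha]; destruct hG as [s <-].
  eexists; symmetry; apply unstable_curve_iter; assumption. }
pose (e := fun i => proj1_sig (constructive_indefinite_description _ (hEex i))).
assert (he : forall i, g (e i) = E i).
{ intros i; exact (proj2_sig (constructive_indefinite_description _ (hEex i))). }
assert (M : marks lam (fun t => fst (g t)) e).
{ split.
  - intros i; destruct (numbering_order _ _ _ _ hE i) as [s [t [es [et hst]]]].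
    rewrite <- hgf, <- he in es, et; apply hinj in es, et; rewrite <- es, <- et.
    apply hinc, hst.
  - intros t; refine (iff_trans _ (basic_unstable_curve a b t hb ha)).
    rewrite (numbering_basic _ _ _ _ hE).
    split; intros [i hi]; exists i.
    + rewrite <- hi; symmetry; apply he.
    + apply hinj; rewrite he; exact hi. }
pose proof (marks_lt _ _ _ M) as hlt.
assert (harc : forall i T, arc phi (E i) (E (i + 1)%Z) T <->
  exists s, e i <= s <= e (i + 1)%Z /\ g s = T).
{ intros i T; rewrite <- !he; apply (arc_lift phi g h); trivial. }
(* Arcs are now intervals of the parameter of [g], and injectivity identifies the preimage in an
   arrow with division by [lam]. *)
assert (hpath : sign_path a b phi E p <-> line_path lam (fun t => fst (g t)) e p).
{ split; intros [B [h1 h2]]; exists B; split.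
  - intros n s hs; destruct (h1 n (g s)) as [Q [hQ eQ]].
    { apply harc; exists s; split; [exact hs|reflexivity]. }
    apply harc in hQ; destruct hQ as [u [hu <-]].
    unfold g in eQ; rewrite <- unstable_curve_lozi in eQ by assumption.
    apply hinj in eQ; subst s; fold lam.
    replace (lam * u / lam) with u by (field; lra); exact hu.
  - intros n s hs; apply h2; split; [|split].
    + apply harc; exists s; split; [lra|reflexivity].
    + rewrite <- he; intros es; apply hinj in es; lra.
    + rewrite <- he; intros es; apply hinj in es; lra.
  - intros n T hT; apply harc in hT; destruct hT as [s [hs <-]].
    exists (g (s / lam)); split.
    + apply harc; exists (s / lam); split; [apply h1, hs|reflexivity].
    + unfold g; rewrite <- unstable_curve_lozi by assumption; fold lam; f_equal; field; lra.
  - intros n T [hT [n1 n2]]; apply harc in hT; destruct hT as [s [hs <-]]; apply h2.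
    rewrite <- he in n1, n2.
    assert (s <> e (B n)) by congruence; assert (s <> e (B n + 1)%Z) by congruence; lra. }
assert (hiter : forall n t, lozi_iter a b n (g t) = g (powerRZ lam n * t)).
{ intros n t; apply unstable_curve_iter; assumption. }
assert (hadm : essential_admissible a b phi p <-> line_essential lam (fun t => fst (g t)) p).
{ assert (hside : forall t l, side_sign a b phi (g t) l (p l) <->
    exists d, 0 < d /\ forall s, 0 < Rabs (s - t) < d ->
      strict_sign (p l) (fst (g (powerRZ lam l * s)))).
  { intros t l; unfold side_sign; rewrite (near_on_lift phi g h) by assumption.
    split; intros [d [hd hs]]; exists d; split; trivial; intros s hst.
    - rewrite <- hiter; apply hs, hst.
    - rewrite hiter; apply hs, hst. }
  split.
  - intros [P [hP [h1 h2]]].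
    apply unstable_range in hP; [|exact hb|exact ha]; destruct hP as [t <-]; fold g in h1, h2.
    exists t; split.
    + intros n; rewrite <- hiter; apply h1.
    + intros k l hk hfirst hkl hxl; apply hside, (h2 k); trivial.
      * split; [rewrite hiter; exact hk|intros n hn; rewrite hiter; apply hfirst, hn].
      * rewrite hiter; exact hxl.
  - intros [t [h1 h2]]; exists (g t); split; [|split].
    + apply unstable_range; [exact hb|exact ha|exists t; reflexivity].
    + intros n; rewrite hiter; apply h1.
    + intros k l [hk hfirst] hkl hxl; rewrite hiter in hk, hxl.
      apply hside, (h2 k); trivial.
      intros n hn; specialize (hfirst n hn); rewrite hiter in hfirst; exact hfirst. }
rewrite hpath, hadm; split.
- apply line_essential_path; assumption.
- apply line_path_essential; assumption.
Qed.
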